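(* Let $K$ be a field, let $A$ be a 2-Calabi-Yau $K$-algebra and let $S,T$ be finite-dimensional rigid simple left $A$-modules, with annihilator ideals $I_S=\mathrm{Ann}_A(S)$ and $I_T=\mathrm{Ann}_A(T)$. Then: (1) $I_SI_S=I_S$. (2) $I_SI_T=I_TI_S$ if $\mathrm{Ext}^1_A(S,T)=0$. (3) $I_SI_TI_S=I_TI_SI_T$ if $\mathrm{Ext}^1_A(S,T)$ is 1-dimensional as a right $\mathrm{End}_A(S)$-module and as a left $\mathrm{End}_A(T)$-module.
   Context: A simple $A$-module $S$ is rigid if $\mathrm{Ext}^1_A(S,S)=0$; $\mathrm{End}_A(S)$ is then a division algebra. Calabi-Yau: regard $A\otimes_KA$ as an $A$-bimodule via the outer actions; for an $A$-bimodule $M$, $\mathrm{Hom}_{AA}(M,A\otimes_KA)$ is an $A$-bimodule via the inner actions. $A$ is homologically smooth if it has a finite projective resolution by finitely generated projective $A$-bimodules, and is $d$-Calabi-Yau if moreover $\mathbf{R}\mathrm{Hom}_{AA}(A,A\otimes_KA)\cong A[-d]$ in the derived category of $A$-bimodules. *)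

(* Defs.v *)
From HB Require Import structures.
From mathcomp Require Import all_boot all_order all_algebra.
From mathcomp Require Import boolp classical_sets.

Set Implicit Arguments.
Unset Strict Implicit.
Unset Printing Implicit Defensive.

Import GRing.Theory.
Local Open Scope ring_scope.

(******************************************************************************)
(* Tensor products over a field.  An element of U (x)_K V is a formal sum     *)
(* u_1 (x) v_1 + ... + u_n (x) v_n, encoded as the list of the (u_i, v_i); two*)
(* formal sums are identified when every K-bilinear map takes the same value  *)
(* on them, so that the universal property holds (tens_lift_tens below).      *)
(******************************************************************************)

Section Tensor.
Variables (K : fieldType) (U V : lmodType K).

Definition bilin_eval (W : lmodType K) (f : U -> V -> W)
  (s : seq (U * V)) : W :=
  \sum_(p <- s) f p.1 p.2.

Definition tens_equiv (s t : seq (U * V)) : bool :=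
  `[< forall (W : lmodType K) (f : {bilinear U -> V -> W}),
        bilin_eval f s = bilin_eval f t >].

Lemma tens_equiv_refl : reflexive tens_equiv.
Proof. by move=> s; apply/asboolP. Qed.

Lemma tens_equiv_sym : symmetric tens_equiv.
Proof. by move=> s t; apply/asboolP/asboolP => st W f; rewrite st. Qed.

Lemma tens_equiv_trans : transitive tens_equiv.
Proof.
by move=> t s r /asboolP st /asboolP tr; apply/asboolP => W f; rewrite st tr.
Qed.

Canonical tens_equiv_rel :=
  EquivRel tens_equiv tens_equiv_refl tens_equiv_sym tens_equiv_trans.

Definition tensor := {eq_quot tens_equiv_rel}%qT.

HB.instance Definition _ := Choice.on tensor.
HB.instance Definition _ := EqQuotient.on tensor.

Definition tens_of (s : seq (U * V)) : tensor := (\pi_tensor s)%qT.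

Definition tens (u : U) (v : V) : tensor := tens_of [:: (u, v)].

Definition tens_lift (W : lmodType K) (f : {bilinear U -> V -> W})
  (x : tensor) : W := bilin_eval f (repr x).

Lemma tens_of_eq (s t : seq (U * V)) :
  (forall (W : lmodType K) (f : {bilinear U -> V -> W}),
     bilin_eval f s = bilin_eval f t) -> tens_of s = tens_of t.
Proof. by move=> st; apply/eqmodP/asboolP. Qed.

Lemma tens_lift_of (W : lmodType K) (f : {bilinear U -> V -> W}) s :
  tens_lift f (tens_of s) = bilin_eval f s.
Proof.
have /eqmodP/asboolP : (repr (tens_of s) = s %[mod tensor])%qT by rewrite reprK.
exact.
Qed.

Lemma tensP (x y : tensor) :
  (forall (W : lmodType K) (f : {bilinear U -> V -> W}),
     tens_lift f x = tens_lift f y) -> x = y.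
Proof. by move=> xy; rewrite -[x]reprK -[y]reprK; apply: tens_of_eq. Qed.

Definition tens_zero : tensor := tens_of [::].
Definition tens_add (x y : tensor) : tensor := tens_of (repr x ++ repr y).
Definition tens_opp (x : tensor) : tensor :=
  tens_of [seq (- p.1, p.2) | p <- repr x].

Lemma tens_lift_zero (W : lmodType K) (f : {bilinear U -> V -> W}) :
  tens_lift f tens_zero = 0.
Proof. by rewrite tens_lift_of /bilin_eval big_nil. Qed.

Lemma tens_lift_add (W : lmodType K) (f : {bilinear U -> V -> W}) x y :
  tens_lift f (tens_add x y) = tens_lift f x + tens_lift f y.
Proof. by rewrite tens_lift_of /bilin_eval big_cat. Qed.

Lemma tens_lift_opp (W : lmodType K) (f : {bilinear U -> V -> W}) x :
  tens_lift f (tens_opp x) = - tens_lift f x.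
Proof.
rewrite tens_lift_of /tens_lift /bilin_eval big_map -sumrN.
by apply: eq_bigr => p _; rewrite linearNl.
Qed.

Lemma tens_addA : associative tens_add.
Proof. by move=> x y z; apply: tensP => W f; rewrite !tens_lift_add addrA. Qed.

Lemma tens_addC : commutative tens_add.
Proof. by move=> x y; apply: tensP => W f; rewrite !tens_lift_add addrC. Qed.

Lemma tens_add0 : left_id tens_zero tens_add.
Proof.
by move=> x; apply: tensP => W f; rewrite tens_lift_add tens_lift_zero add0r.
Qed.

Lemma tens_addN : left_inverse tens_zero tens_opp tens_add.
Proof.
move=> x; apply: tensP => W f.
by rewrite tens_lift_add tens_lift_opp tens_lift_zero addNr.
Qed.

HB.instance Definition _ :=
  GRing.isZmodule.Build tensor tens_addA tens_addC tens_add0 tens_addN.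

Lemma tens_liftD (W : lmodType K) (f : {bilinear U -> V -> W}) :
  {morph tens_lift f : x y / x + y}.
Proof. exact: tens_lift_add. Qed.

Lemma tens_lift_tens (W : lmodType K) (f : {bilinear U -> V -> W}) u v :
  tens_lift f (tens u v) = f u v.
Proof. by rewrite tens_lift_of /bilin_eval big_seq1. Qed.

Lemma tens_ind (P : tensor -> Prop) : P 0 ->
  (forall u v x, P x -> P (tens u v + x)) -> forall x, P x.
Proof.
move=> P0 PD x; rewrite -[x]reprK; elim: (repr x) => [|[u v] s IHs] //.
suff -> : (\pi_tensor ((u, v) :: s))%qT = tens u v + tens_of s by exact: PD.
apply: tensP => W f; rewrite tens_liftD tens_lift_tens !tens_lift_of.
by rewrite /bilin_eval big_cons.
Qed.

End Tensor.

Section TensorMap.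
Variables (K : fieldType) (U V U' V' : lmodType K).
Variables (g : {linear U -> U'}) (h : {linear V -> V'}).

Definition tens_map (x : tensor U V) : tensor U' V' :=
  tens_of [seq (g p.1, h p.2) | p <- repr x].

Section Comp.
Variables (W : lmodType K) (f : {bilinear U' -> V' -> W}).
Definition bilin_comp (u : U) (v : V) : W := f (g u) (h v).
Lemma bilin_comp_bilinear : bilinear_for *:%R *:%R bilin_comp.
Proof.
split=> [v a u u'|u a v v']; rewrite /bilin_comp linearP.
  by rewrite linearPl.
by rewrite linearPr.
Qed.
HB.instance Definition _ := bilinear_isBilinear.Build K U V W *:%R *:%R
  bilin_comp bilin_comp_bilinear.
Lemma tens_lift_map x : tens_lift f (tens_map x) = tens_lift bilin_comp x.
Proof. by rewrite tens_lift_of /bilin_eval big_map. Qed.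
End Comp.

Lemma tens_mapD : {morph tens_map : x y / x + y}.
Proof.
by move=> x y; apply: tensP => W f; rewrite tens_liftD !tens_lift_map tens_liftD.
Qed.

Lemma tens_map_tens u v : tens_map (tens u v) = tens (g u) (h v).
Proof. by apply: tensP => W f; rewrite tens_lift_map !tens_lift_tens. Qed.

End TensorMap.

(******************************************************************************)
(* Bimodules.  K is assumed to act centrally, i.e. an A-bimodule is a module  *)
(* over A (x)_K A^op.                                                         *)
(******************************************************************************)

Section Bimodules.
Variables (K : fieldType) (A : algType K).

Record bimodule := Bimodule {
  bimod_sort :> lmodType A;
  ract : bimod_sort -> A -> bimod_sort;
  ractDl : forall x y a, ract (x + y) a = ract x a + ract y a;
  ractDr : forall x a b, ract x (a + b) = ract x a + ract x b;
  ract1 : forall x, ract x 1 = x;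
  ractM : forall x a b, ract x (a * b) = ract (ract x a) b;
  ract_lact : forall a x b, ract (a *: x) b = a *: ract x b;
  ract_central : forall x (k : K), ract x k%:A = k%:A *: x
}.

Record bihom (M N : bimodule) := Bihom {
  bihom_fun :> M -> N;
  bihom_linear : linear bihom_fun;
  bihom_ract : forall x a, bihom_fun (ract x a) = ract (bihom_fun x) a
}.

Lemma bihomP (M N : bimodule) (f g : bihom M N) : f =1 g -> f = g.
Proof.
case: f g => [f fl fr] [g gl gr] /= /funext fg; subst g.
by rewrite (Prop_irrelevance fl gl) (Prop_irrelevance fr gr).
Qed.

Lemma bihom0 (M N : bimodule) (f : bihom M N) : f 0 = 0.
Proof. by have := bihom_linear f (-1) 0 0; rewrite !scaleN1r !addNr. Qed.

Lemma bihomD (M N : bimodule) (f : bihom M N) : {morph f : x y / x + y}.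
Proof. by move=> x y; have := bihom_linear f 1 x y; rewrite !scale1r. Qed.

Lemma bihomZ (M N : bimodule) (f : bihom M N) a x : f (a *: x) = a *: f x.
Proof. by have := bihom_linear f a x 0; rewrite bihom0 !addr0. Qed.

Lemma ract0 (M : bimodule) (a : A) : ract (0 : M) a = 0.
Proof. by apply: (@addrI _ (ract 0 a)); rewrite -ractDl !addr0. Qed.

Lemma ractN (M : bimodule) (x : M) (a : A) : ract (- x) a = - ract x a.
Proof. by apply/eqP; rewrite -addr_eq0 -ractDl addNr ract0. Qed.

Definition bihom_zero_fun (M N : bimodule) (x : M) : N := 0.

Lemma bihom_zero_linear M N : linear (@bihom_zero_fun M N).
Proof. by move=> a x y; rewrite /bihom_zero_fun scaler0 addr0. Qed.

Lemma bihom_zero_ract M N x a :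
  bihom_zero_fun N (@ract M x a) = ract (bihom_zero_fun N x) a.
Proof. by rewrite /bihom_zero_fun ract0. Qed.

Definition bihom_zero (M N : bimodule) : bihom M N :=
  Bihom (@bihom_zero_linear M N) (@bihom_zero_ract M N).

Definition bimod_reg : bimodule.
refine (@Bimodule A^o (fun x a => (x : A) * a) _ _ _ _ _ _).
- by move=> x y a; rewrite mulrDl.
- by move=> x a b; rewrite mulrDr.
- by move=> x; rewrite mulr1.
- by move=> x a b; rewrite mulrA.
- by move=> a x b; rewrite /GRing.scale /= mulrA.
- by move=> x k; rewrite /GRing.scale /= mulr_algl mulr_algr.
Defined.

Definition bimod_zero : bimodule.
refine (@Bimodule 'rV[A]_0 (fun x _ => x) _ _ _ _ _ _) => //.
- by move=> x a b; apply/matrixP => i [].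
- by move=> x k; apply/matrixP => i [].
Defined.

(* A (x)_K A, with outer bimodule structure a.(x (x) y).b = ax (x) yb and     *)
(* inner bimodule structure a.(x (x) y).b = xb (x) ay.                        *)

Definition lmul (a x : A) : A := a * x.
Lemma lmul_linear a : linear (lmul a).
Proof. by move=> k x y; rewrite /lmul mulrDr scalerAr. Qed.
HB.instance Definition _ a :=
  GRing.isLinear.Build K A A *:%R (lmul a) (lmul_linear a).

Definition rmul (a x : A) : A := x * a.
Lemma rmul_linear a : linear (rmul a).
Proof. by move=> k x y; rewrite /rmul mulrDl scalerAl. Qed.
HB.instance Definition _ a :=
  GRing.isLinear.Build K A A *:%R (rmul a) (rmul_linear a).

Definition tensAA := tensor A A.
HB.instance Definition _ := GRing.Zmodule.on tensAA.

Definition outer_l (a : A) : tensAA -> tensAA := tens_map (lmul a) idfun.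
Definition outer_r (a : A) : tensAA -> tensAA := tens_map idfun (rmul a).
Definition inner_l (a : A) : tensAA -> tensAA := tens_map idfun (lmul a).
Definition inner_r (a : A) : tensAA -> tensAA := tens_map (rmul a) idfun.

Lemma tens_eqP (f g : tensAA -> tensAA) :
  {morph f : x y / x + y} -> {morph g : x y / x + y} ->
  (forall x y, f (tens x y) = g (tens x y)) -> f =1 g.
Proof.
move=> fD gD fg; elim/tens_ind => [|u v x IHx]; last by rewrite fD gD fg IHx.
have f0 : f 0 = 0 by apply: (@addrI _ (f 0)); rewrite -fD !addr0.
by have g0 : g 0 = 0; [apply: (@addrI _ (g 0)); rewrite -gD !addr0 | rewrite f0].
Qed.

Lemma tensDl (x x' y : A) : tens (x + x') y = tens x y + tens x' y :> tensAA.
Proof.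
by apply: tensP => W f; rewrite tens_liftD !tens_lift_tens linearDl.
Qed.

Lemma tensDr (x y y' : A) : tens x (y + y') = tens x y + tens x y' :> tensAA.
Proof.
by apply: tensP => W f; rewrite tens_liftD !tens_lift_tens linearDr.
Qed.

Lemma tensZ (k : K) (x y : A) : tens (k *: x) y = tens x (k *: y) :> tensAA.
Proof. by apply: tensP => W f; rewrite !tens_lift_tens linearZl linearZr. Qed.


Lemma outer_lA a b x : outer_l a (outer_l b x) = outer_l (a * b) x.
Proof.
move: x; apply: tens_eqP => [x y|x y|x y]; rewrite /outer_l ?tens_mapD //.
by rewrite !tens_map_tens /= /lmul mulrA.
Qed.

Lemma outer_l1 : left_id 1 outer_l.
Proof.
apply: tens_eqP => [x y|x y|x y]; rewrite /outer_l ?tens_mapD //.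
by rewrite tens_map_tens /= /lmul mul1r.
Qed.

Lemma outer_lDr : right_distributive outer_l +%R.
Proof. by move=> a x y; rewrite /outer_l tens_mapD. Qed.

Lemma outer_lDl x : {morph outer_l^~ x : a b / a + b}.
Proof.
move=> a b; move: x; apply: tens_eqP => [x y|x y|x y].
- by rewrite /outer_l tens_mapD.
- by rewrite /outer_l !tens_mapD addrACA.
- by rewrite /outer_l !tens_map_tens /= /lmul mulrDl tensDl.
Qed.

HB.instance Definition _ := GRing.Zmodule_isLmodule.Build A tensAA
  outer_lA outer_l1 outer_lDr outer_lDl.

Definition bimod_tensAA : bimodule.
refine (@Bimodule tensAA (fun x a => outer_r a x) _ _ _ _ _ _).
- by move=> x y a; rewrite /outer_r tens_mapD.
- move=> x a b; move: x; apply: tens_eqP => [x y|x y|x y].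
  + by rewrite /outer_r tens_mapD.
  + by rewrite /outer_r !tens_mapD addrACA.
  + by rewrite /outer_r !tens_map_tens /= /rmul mulrDr tensDr.
- apply: tens_eqP => [x y|x y|x y]; rewrite /outer_r ?tens_mapD //.
  by rewrite tens_map_tens /= /rmul mulr1.
- move=> x a b; move: x.
  apply: tens_eqP => [x y|x y|x y]; rewrite /outer_r ?tens_mapD //.
  by rewrite !tens_map_tens /= /rmul mulrA.
- move=> a x b; rewrite /GRing.scale /=; move: x.
  apply: tens_eqP => [x y|x y|x y]; rewrite /outer_r /outer_l ?tens_mapD //.
  by rewrite !tens_map_tens.
- move=> x k; rewrite /GRing.scale /=; move: x.
  apply: tens_eqP => [x y|x y|x y]; rewrite /outer_r /outer_l ?tens_mapD //.
  by rewrite !tens_map_tens /= /rmul /lmul mulr_algl mulr_algr tensZ.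
Defined.

Lemma inner_l_outer a b x : inner_l a (b *: x) = b *: inner_l a x.
Proof.
rewrite /GRing.scale /=; move: x.
apply: tens_eqP => [x y|x y|x y]; rewrite /inner_l /outer_l ?tens_mapD //.
by rewrite !tens_map_tens.
Qed.

Lemma inner_l_ract a b (x : bimod_tensAA) :
  inner_l a (ract x b) = ract (inner_l a x : bimod_tensAA) b.
Proof.
rewrite /=; move: x.
apply: tens_eqP => [x y|x y|x y]; rewrite /inner_l /outer_r ?tens_mapD //.
by rewrite !tens_map_tens /= /lmul /rmul mulrA.
Qed.

Lemma inner_r_outer a b x : inner_r a (b *: x) = b *: inner_r a x.
Proof.
rewrite /GRing.scale /=; move: x.
apply: tens_eqP => [x y|x y|x y]; rewrite /inner_r /outer_l ?tens_mapD //.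
by rewrite !tens_map_tens /= /lmul /rmul mulrA.
Qed.

Lemma inner_r_ract a b (x : bimod_tensAA) :
  inner_r a (ract x b) = ract (inner_r a x : bimod_tensAA) b.
Proof.
rewrite /=; move: x.
apply: tens_eqP => [x y|x y|x y]; rewrite /inner_r /outer_r ?tens_mapD //.
by rewrite !tens_map_tens.
Qed.

(* The bimodule Hom_AA(M, A (x) A): homomorphisms for the outer structure,    *)
(* acted upon through the inner structure.                                    *)

Section Dual.
Variable M : bimodule.

Definition dual := bihom M bimod_tensAA.

HB.instance Definition _ := gen_eqMixin dual.
HB.instance Definition _ := gen_choiceMixin dual.

Implicit Types f g : dual.

Definition dual_add f g : dual.
refine (@Bihom M bimod_tensAA (fun x => f x + g x) _ _).
- by move=> a x y; rewrite !bihom_linear scalerDr addrACA.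
- by move=> x a; rewrite !bihom_ract ractDl.
Defined.

Definition dual_opp f : dual.
refine (@Bihom M bimod_tensAA (fun x => - f x) _ _).
- by move=> a x y; rewrite !bihom_linear opprD scalerN.
- by move=> x a; rewrite !bihom_ract ractN.
Defined.

Definition dual_lact (a : A) f : dual.
refine (@Bihom M bimod_tensAA (fun x => inner_l a (f x)) _ _).
- by move=> b x y; rewrite bihom_linear /inner_l tens_mapD -!/(inner_l _ _) inner_l_outer.
- by move=> x b; rewrite bihom_ract inner_l_ract.
Defined.

Definition dual_ract f (a : A) : dual.
refine (@Bihom M bimod_tensAA (fun x => inner_r a (f x)) _ _).
- by move=> b x y; rewrite bihom_linear /inner_r tens_mapD -!/(inner_r _ _) inner_r_outer.
- by move=> x b; rewrite bihom_ract inner_r_ract.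
Defined.

Lemma dual_addA : associative dual_add.
Proof. by move=> f g h; apply: bihomP => x /=; rewrite addrA. Qed.
Lemma dual_addC : commutative dual_add.
Proof. by move=> f g; apply: bihomP => x /=; rewrite addrC. Qed.
Lemma dual_add0 : left_id (bihom_zero M bimod_tensAA : dual) dual_add.
Proof. by move=> f; apply: bihomP => x /=; rewrite /bihom_zero_fun add0r. Qed.
Lemma dual_addN :
  left_inverse (bihom_zero M bimod_tensAA : dual) dual_opp dual_add.
Proof. by move=> f; apply: bihomP => x /=; rewrite addNr. Qed.

HB.instance Definition _ :=
  GRing.isZmodule.Build dual dual_addA dual_addC dual_add0 dual_addN.

Lemma dual_lactA a b f : dual_lact a (dual_lact b f) = dual_lact (a * b) f.
Proof.
apply: bihomP => x /=; move: (f x).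
apply: tens_eqP => [y z|y z|y z]; rewrite /inner_l ?tens_mapD //.
by rewrite !tens_map_tens /= /lmul mulrA.
Qed.
Lemma dual_lact1 : left_id 1 dual_lact.
Proof.
move=> f; apply: bihomP => x /=; move: (f x).
apply: tens_eqP => [y z|y z|y z]; rewrite /inner_l ?tens_mapD //.
by rewrite tens_map_tens /= /lmul mul1r.
Qed.
Lemma dual_lactDr : right_distributive dual_lact +%R.
Proof. by move=> a f g; apply: bihomP => x; rewrite /= /inner_l tens_mapD. Qed.
Lemma dual_lactDl f : {morph dual_lact^~ f : a b / a + b}.
Proof.
move=> a b; apply: bihomP => x /=; move: (f x).
apply: tens_eqP => [y z|y z|y z].
- by rewrite /inner_l tens_mapD.
- by rewrite /inner_l !tens_mapD addrACA.
- by rewrite /inner_l !tens_map_tens /= /lmul mulrDl tensDr.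
Qed.

HB.instance Definition _ := GRing.Zmodule_isLmodule.Build A dual
  dual_lactA dual_lact1 dual_lactDr dual_lactDl.

Definition bimod_dual : bimodule.
refine (@Bimodule dual dual_ract _ _ _ _ _ _).
- by move=> f g a; apply: bihomP => x; rewrite /= /inner_r tens_mapD.
- move=> f a b; apply: bihomP => x /=; move: (f x).
  apply: tens_eqP => [y z|y z|y z].
  + by rewrite /inner_r tens_mapD.
  + by rewrite /inner_r !tens_mapD addrACA.
  + by rewrite /inner_r !tens_map_tens /= /rmul mulrDr tensDl.
- move=> f; apply: bihomP => x /=; move: (f x).
  apply: tens_eqP => [y z|y z|y z]; rewrite /inner_r ?tens_mapD //.
  by rewrite tens_map_tens /= /rmul mulr1.
- move=> f a b; apply: bihomP => x /=; move: (f x).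
  apply: tens_eqP => [y z|y z|y z]; rewrite /inner_r ?tens_mapD //.
  by rewrite !tens_map_tens /= /rmul mulrA.
- move=> a f b; apply: bihomP => x /=; move: (f x).
  apply: tens_eqP => [y z|y z|y z]; rewrite /inner_l /inner_r ?tens_mapD //.
  by rewrite !tens_map_tens.
- move=> f k; apply: bihomP => x /=; move: (f x).
  apply: tens_eqP => [y z|y z|y z]; rewrite /inner_l /inner_r ?tens_mapD //.
  by rewrite !tens_map_tens /= /rmul /lmul mulr_algl mulr_algr tensZ.
Defined.

End Dual.

Definition bihom_comp (L M N : bimodule) (g : bihom M N) (f : bihom L M) :
  bihom L N.
refine (@Bihom L N (fun x => g (f x)) _ _).
- by move=> a x y; rewrite !bihom_linear.
- by move=> x a; rewrite !bihom_ract.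
Defined.

Definition dual_map (M N : bimodule) (u : bihom M N) :
  bihom (bimod_dual N) (bimod_dual M).
refine (@Bihom (bimod_dual N) (bimod_dual M)
  (fun f => bihom_comp (f : dual N) u) _ _).
- by move=> a f g; apply: bihomP.
- by move=> f a; apply: bihomP.
Defined.

(******************************************************************************)
(* Cochain complexes of bimodules, indexed by int.  The differential is given *)
(* for all pairs of indices and vanishes unless j = i + 1; this avoids casts. *)
(******************************************************************************)

Record complex := Complex {
  cx_ob :> int -> bimodule;
  cx_d : forall i j, bihom (cx_ob i) (cx_ob j);
  cx_shape : forall i j, j != i + 1 -> forall x, cx_d i j x = 0;
  cx_dd : forall i j k x, cx_d j k (cx_d i j x) = 0
}.

Definition cocycle (X : complex) (i : int) : set (X i) :=
  [set x | cx_d X i (i + 1) x = 0].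

Definition coboundary (X : complex) (i : int) : set (X i) :=
  [set x | exists y, cx_d X (i - 1) i y = x].

Record chain_map (X Y : complex) := ChainMap {
  cm_fun :> forall i, bihom (X i) (Y i);
  cm_comm : forall i j x, cm_fun j (cx_d X i j x) = cx_d Y i j (cm_fun i x)
}.

(* The two clauses say that H^i(f) is injective, resp. surjective.            *)
Definition quasi_iso (X Y : complex) (f : chain_map X Y) : Prop :=
  forall i,
    (forall x : X i, cocycle x -> coboundary (f i x) -> coboundary x) /\
    (forall y : Y i, cocycle y ->
       exists2 x : X i, cocycle x & coboundary (y - f i x)).

(* Every morphism of the derived category is a roof X <- Z -> Y whose first   *)
(* leg is a quasi-isomorphism, and it is invertible iff the second leg is too.*)
Definition derived_iso (X Y : complex) : Prop :=
  exists (Z : complex) (f : chain_map Z X) (g : chain_map Z Y),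
    quasi_iso f /\ quasi_iso g.

(* M[-n]: the complex with M in degree n and 0 elsewhere.                     *)
Definition stalk (n : int) (M : bimodule) : complex.
refine (@Complex (fun i => if i == n then M else bimod_zero)
  (fun i j => bihom_zero _ _) _ _) => //.
Defined.

Definition dual_complex (P : complex) : complex.
refine (@Complex (fun i => bimod_dual (P (- i)))
  (fun i j => dual_map (cx_d P (- j) (- i))) _ _).
- move=> i j ij f; apply: bihomP => x /=; rewrite cx_shape ?bihom0 //.
  by apply: contra ij => /eqP ij; rewrite -[j]opprK -[i]opprK ij opprD subrK.
- by move=> i j k f; apply: bihomP => x /=; rewrite cx_dd bihom0.
Defined.

Definition bimod_fg (M : bimodule) : Prop :=
  exists (n : nat) (g : 'I_n -> M), forall x : M,
    exists (m : nat) (a b : 'I_m -> A) (k : 'I_m -> 'I_n),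
      x = \sum_(j < m) ract (a j *: g (k j)) (b j).

Definition bimod_projective (P : bimodule) : Prop :=
  forall (M N : bimodule) (p : bihom M N) (f : bihom P N),
    (forall y, exists x, p x = y) ->
    exists h : bihom P M, forall x, p (h x) = f x.

(* In cohomological indexing the n-th term of the resolution is P (- n).      *)
Definition finite_fgproj_resolution (P : complex) (M : bimodule)
    (e : chain_map P (stalk 0 M)) : Prop :=
  [/\ forall i, bimod_fg (P i) /\ bimod_projective (P i),
      exists n : nat, forall i : int,
        ((0 < i) || (i < - n%:Z))%R -> forall x : P i, x = 0
    & quasi_iso e].

Definition homologically_smooth : Prop :=
  exists (P : complex) (e : chain_map P (stalk 0 bimod_reg)),
    finite_fgproj_resolution e.

(* RHom_AA(A, A (x) A) is computed by dual_complex P for a projective         *)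
(* resolution P of A; the choice of P does not matter up to derived_iso.      *)
Definition calabi_yau (d : nat) : Prop :=
  exists (P : complex) (e : chain_map P (stalk 0 bimod_reg)),
    finite_fgproj_resolution e /\
    derived_iso (dual_complex P) (stalk d%:Z bimod_reg).

Lemma calabi_yau_smooth d : calabi_yau d -> homologically_smooth.
Proof. by move=> [P [e [Pe _]]]; exists P, e. Qed.

End Bimodules.

Section Modules.
Variables (K : fieldType) (A : algType K).

Definition fin_dim (S : lmodType A) : Prop :=
  exists (n : nat) (e : 'I_n -> S), forall s : S,
    exists c : 'I_n -> K, s = \sum_(i < n) (c i)%:A *: e i.

Definition simple_module (S : lmodType A) : Prop :=
  (exists s : S, s != 0) /\
  forall U : {pred S}, submod_closed U -> U =i pred1 0 \/ U =i predT.

Definition Ann (S : lmodType A) : set A := [set a | forall s : S, a *: s = 0].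

Definition ideal_mul (I J : set A) : set A :=
  [set a | exists (n : nat) (x y : 'I_n -> A),
     [/\ forall i, I (x i), forall i, J (y i) & a = \sum_(i < n) x i * y i]].

(* A short exact sequence 0 -> T -> E -> S -> 0, i.e. a representative of an  *)
(* element of Ext^1_A(S, T).                                                  *)
Record extension (S T : lmodType A) := Extension {
  ext_mod :> lmodType A;
  ext_in : {linear T -> ext_mod};
  ext_out : {linear ext_mod -> S};
  ext_in_inj : injective ext_in;
  ext_out_surj : forall s, exists x, ext_out x = s;
  ext_exact : forall x, ext_out x = 0 <-> exists t, ext_in t = x
}.

(* A morphism of short exact sequences from eta to xi that is phi on the      *)
(* submodules and psi on the quotients.                                       *)
Definition ext_morphism (S T S' T' : lmodType A)
    (phi : T -> T') (psi : S -> S')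
    (eta : extension S T) (xi : extension S' T') : Prop :=
  exists h : {linear eta -> xi},
    (forall t, h (ext_in eta t) = ext_in xi (phi t)) /\
    (forall x, ext_out xi (h x) = psi (ext_out eta x)).

(* eta = xi . psi in Ext^1_A(S, T): eta is the pullback of xi along psi.      *)
Definition ext_ract (S T : lmodType A) (xi : extension S T)
    (psi : {linear S -> S}) (eta : extension S T) : Prop :=
  ext_morphism idfun psi eta xi.

(* eta = phi . xi in Ext^1_A(S, T): eta is the pushout of xi along phi.       *)
Definition ext_lact (S T : lmodType A) (phi : {linear T -> T})
    (xi : extension S T) (eta : extension S T) : Prop :=
  ext_morphism phi idfun xi eta.

(* xi represents 0 in Ext^1_A(S, T).                                          *)
Definition ext_split (S T : lmodType A) (xi : extension S T) : Prop :=
  exists s : {linear S -> xi}, forall x, ext_out xi (s x) = x.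

Definition Ext1_zero (S T : lmodType A) : Prop :=
  forall xi : extension S T, ext_split xi.

Definition rigid (S : lmodType A) : Prop := Ext1_zero S S.

(* Some class xi is a basis of Ext^1_A(S, T) over End_A(S) (resp. End_A(T)):  *)
(* every class is a multiple of xi for a unique scalar.                       *)
Definition Ext1_dim1_right (S T : lmodType A) : Prop :=
  exists xi : extension S T, forall eta : extension S T,
    exists psi : {linear S -> S}, ext_ract xi psi eta /\
      forall psi' : {linear S -> S}, ext_ract xi psi' eta -> psi' =1 psi.

Definition Ext1_dim1_left (S T : lmodType A) : Prop :=
  exists xi : extension S T, forall eta : extension S T,
    exists phi : {linear T -> T}, ext_lact phi xi eta /\
      forall phi' : {linear T -> T}, ext_lact phi' xi eta -> phi' =1 phi.

End Modules.

(* Main.v *)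
(* The proof rests on one consequence of the 2-Calabi-Yau property: for       *)
(* finite-dimensional X and Y, Ext^1(X, Y) = 0 implies Ext^1(Y, X) = 0.       *)
(* Indeed let P be a finite resolution of A by finitely generated projective  *)
(* bimodules and P^v its dual, so that P^v[2] is again a resolution of A.     *)
(* For P_i finitely generated projective, Hom(P_i^v, Hom_K(Y, X)) is the      *)
(* K-dual of Hom(P_i, Hom_K(X, Y)) by the trace form, so the vanishing of     *)
(* H^1 of Hom(P, Hom_K(X, Y)) gives that of H^1 of Hom(P^v[2], Hom_K(Y, X)).  *)
(*                                                                            *)
(* If Ext^1(T, S) = 0 then I_S I_T is the intersection of I_S and I_T: an     *)
(* element x of I_T outside I_S I_T is detected by a homomorphism I_T -> S    *)
(* vanishing on I_S I_T, which extends to A because A / I_T is a power of T;  *)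
(* so x does not annihilate S.  This yields (1) and (2).                      *)
(*                                                                            *)
(* For (3), let 0 -> T -> E -> S -> 0 be the nonsplit extension.  The         *)
(* one-dimensionality of Ext^1(S, T) gives Ext^1(E, T) = Ext^1(S, E) = 0, and *)
(* then Ext^1(T, E) = Ext^1(E, S) = 0 by symmetry; moreover I_T I_S E = 0.    *)
(* Thus E is relatively injective and relatively projective for S and T.  The *)
(* former embeds enough of A / I_T I_S I_T into E to see that it is killed by *)
(* I_S I_T I_S, and the latter covers enough of A / I_S I_T I_S by E to see   *)
(* that it is killed by I_T I_S I_T.                                          *)

Require Import Defs.
From HB Require Import structures.
From mathcomp Require Import all_boot all_order all_algebra.
From mathcomp Require Import boolp classical_sets.
From mathcomp Require Import ring.

Set Implicit Arguments.
Unset Strict Implicit.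
Unset Printing Implicit Defensive.

Import Order.TTheory GRing.Theory Num.Theory.
Local Open Scope ring_scope.

(** * K-linear maps, derivations and Ext^1 *)

(** The vanishing of Ext^1(X, Y) is used in the form [ext0]: every derivation A -> Hom_K(X, Y) is
    inner. In this form it says that Hom(P, Hom_K(X, Y)) is exact in degree 1 for a bimodule
    resolution P of A ([ext0_bimod_exact]). The trace form carries this exactness to the dual of P
    ([dual_exact]), and the cohomology class of the dual complex corresponding to 1 in A then makes
    every derivation A -> Hom_K(Y, X) inner ([cy2_ext0]).

    Ideals are compared by detecting elements. If Ann S maps a left ideal L into a smaller one C0,
    an element of L outside C0 has nonzero image under some homomorphism L -> S vanishing on C0
    ([isotypic_separation]). Quotients such as A / I_T and I_T / I_S I_T are filtered by finitely
    many copies of T or S; for the second, finiteness comes from the resolution of A, through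
    [fin_gen_Ann]. Hence vanishing of Ext^1 extends homomorphisms step by step to A ([filt_extend]),
    where G(x) = x G(1) and it suffices that x kills the target. The reverse inclusion of the braid
    relation lifts generators instead ([filt_lift]). The vanishing needed for the middle term of the
    nonsplit extension comes from the long exact sequences behind [ext0_middle_left] and
    [ext0_middle_right], followed by the symmetry. *)

Section KLinear.
Variables (K : fieldType) (A : algType K).
Implicit Types X Y L : lmodType A.

Record homK X Y := HomK {
  homK_fun :> X -> Y;
  homK_linear : forall (k : K) x y,
    homK_fun (k%:A *: x + y) = k%:A *: homK_fun x + homK_fun y
}.

Lemma homKP X Y (f g : homK X Y) : f =1 g -> f = g.
Proof.
case: f g => [f fl] [g gl] /= /funext fg; subst g.
by rewrite (Prop_irrelevance fl gl).
Qed.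

Lemma homKD X Y (f : homK X Y) : {morph f : x y / x + y}.
Proof. by move=> x y; have := homK_linear f 1 x y; rewrite !scale1r. Qed.

Lemma homK0 X Y (f : homK X Y) : f 0 = 0.
Proof. by apply: (@addrI _ (f 0)); rewrite -homKD !addr0. Qed.

Lemma homKZ X Y (f : homK X Y) (k : K) x : f (k%:A *: x) = k%:A *: f x.
Proof. by have := homK_linear f k x 0; rewrite homK0 !addr0. Qed.

Lemma homK_sum X Y (f : homK X Y) n (F : 'I_n -> X) :
  f (\sum_i F i) = \sum_i f (F i).
Proof. exact: (big_morph f (homKD f) (homK0 f)). Qed.

Lemma scalar_comm (k : K) (a : A) : k%:A * a = a * k%:A.
Proof. by rewrite mulr_algl mulr_algr. Qed.

Lemma algZC X (k : K) (a : A) (x : X) : k%:A *: (a *: x) = a *: (k%:A *: x).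
Proof. by rewrite !scalerA scalar_comm. Qed.

Lemma homK_of_linear_proof X Y (f : {linear X -> Y}) (k : K) x y :
  f (k%:A *: x + y) = k%:A *: f x + f y.
Proof. exact: linearP. Qed.

Definition homK_of_linear X Y (f : {linear X -> Y}) : homK X Y :=
  HomK (homK_of_linear_proof f).

Section Bimodule.
Variables X Y : lmodType A.
Implicit Types f g : homK X Y.

HB.instance Definition _ := gen_eqMixin (homK X Y).
HB.instance Definition _ := gen_choiceMixin (homK X Y).

Definition homK_zero : homK X Y.
refine (@HomK X Y (fun=> 0) _).
by move=> k x y; rewrite scaler0 addr0.
Defined.

Definition homK_add f g : homK X Y.
refine (@HomK X Y (fun x => f x + g x) _).
by move=> k x y; rewrite !homK_linear scalerDr addrACA.
Defined.

Definition homK_opp f : homK X Y.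
refine (@HomK X Y (fun x => - f x) _).
by move=> k x y; rewrite !homK_linear opprD scalerN.
Defined.

Definition homK_lact (a : A) f : homK X Y.
refine (@HomK X Y (fun x => a *: f x) _).
by move=> k x y; rewrite !homK_linear scalerDr algZC.
Defined.

Definition homK_ract f (a : A) : homK X Y.
refine (@HomK X Y (fun x => f (a *: x)) _).
by move=> k x y; rewrite scalerDr -algZC homK_linear.
Defined.

Lemma homK_addA : associative homK_add.
Proof. by move=> f g h; apply: homKP => x /=; rewrite addrA. Qed.
Lemma homK_addC : commutative homK_add.
Proof. by move=> f g; apply: homKP => x /=; rewrite addrC. Qed.
Lemma homK_add0 : left_id homK_zero homK_add.
Proof. by move=> f; apply: homKP => x /=; rewrite add0r. Qed.
Lemma homK_addN : left_inverse homK_zero homK_opp homK_add.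
Proof. by move=> f; apply: homKP => x /=; rewrite addNr. Qed.

HB.instance Definition _ :=
  GRing.isZmodule.Build (homK X Y) homK_addA homK_addC homK_add0 homK_addN.

Lemma homK_lactA a b f : homK_lact a (homK_lact b f) = homK_lact (a * b) f.
Proof. by apply: homKP => x /=; rewrite scalerA. Qed.
Lemma homK_lact1 : left_id 1 homK_lact.
Proof. by move=> f; apply: homKP => x /=; rewrite scale1r. Qed.
Lemma homK_lactDr : right_distributive homK_lact +%R.
Proof. by move=> a f g; apply: homKP => x /=; rewrite scalerDr. Qed.
Lemma homK_lactDl f : {morph homK_lact^~ f : a b / a + b}.
Proof. by move=> a b; apply: homKP => x /=; rewrite scalerDl. Qed.

HB.instance Definition _ := GRing.Zmodule_isLmodule.Build A (homK X Y)
  homK_lactA homK_lact1 homK_lactDr homK_lactDl.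

Definition bimod_homK : bimodule A.
refine (@Bimodule K A (homK X Y) homK_ract _ _ _ _ _ _).
- by move=> f g a; apply: homKP.
- by move=> f a b; apply: homKP => x /=; rewrite scalerDl homKD.
- by move=> f; apply: homKP => x /=; rewrite scale1r.
- by move=> f a b; apply: homKP => x /=; rewrite scalerA.
- by move=> a f b; apply: homKP.
- by move=> f k; apply: homKP => x /=; rewrite homKZ.
Defined.

End Bimodule.

(** Vanishing on scalars, together with the product rule, forces K-linearity in both arguments,
    since scalars are central in A. *)
Record derivation X Y := Derivation {
  der_fun :> A -> X -> Y;
  derDl : forall a b x, der_fun (a + b) x = der_fun a x + der_fun b x;
  derDr : forall a x y, der_fun a (x + y) = der_fun a x + der_fun a y;
  derM : forall a b x,
    der_fun (a * b) x = a *: der_fun b x + der_fun a (b *: x);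
  der_alg : forall (k : K) x, der_fun k%:A x = 0
}.

(* Ext^1(X, Y) = 0, expressed by Hochschild 1-cocycles with values in         *)
(* Hom_K(X, Y).                                                               *)
Definition ext0 X Y : Prop := forall d : derivation X Y,
  exists t : homK X Y, forall a x, d a x = a *: t x - t (a *: x).

Section Twist.
Variables (X Y : lmodType A) (d : derivation X Y).

(** The middle term of the extension of X by Y with class [d]. The derivation enters only through
    the action, so the type carries it as a phantom argument. *)
Definition twist of derivation X Y := (Y * X)%type.
HB.instance Definition _ := GRing.Zmodule.on (twist d).

Definition twist_act (a : A) (u : twist d) : twist d :=
  (a *: u.1 + d a u.2, a *: u.2).

Lemma twist_actA a b u : twist_act a (twist_act b u) = twist_act (a * b) u.
Proof. by rewrite /twist_act /= derM scalerDr !scalerA addrA. Qed.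
Lemma twist_act1 : left_id 1 twist_act.
Proof.
move=> [y x]; have d1 : d 1 x = 0 by rewrite -[1]scale1r der_alg.
by rewrite /twist_act /= d1 !scale1r addr0.
Qed.
Lemma twist_actDr : right_distributive twist_act +%R.
Proof.
by move=> a [y x] [y' x']; congr pair; rewrite /= ?derDr scalerDr // addrACA.
Qed.
Lemma twist_actDl u : {morph twist_act^~ u : a b / a + b}.
Proof. by move=> a b; congr pair; rewrite /= ?derDl scalerDl // addrACA. Qed.

HB.instance Definition _ := GRing.Zmodule_isLmodule.Build A (twist d)
  twist_actA twist_act1 twist_actDr twist_actDl.

Definition twist_in (y : Y) : twist d := (y, 0).
Definition twist_out (u : twist d) : X := u.2.

Lemma der0 a : d a 0 = 0.
Proof. by apply: (@addrI _ (d a 0)); rewrite -derDr !addr0. Qed.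

Lemma twist_in_linear : linear twist_in.
Proof.
by move=> a y y'; congr pair; rewrite /= ?der0 ?scaler0 ?addr0.
Qed.
HB.instance Definition _ :=
  GRing.isLinear.Build A Y (twist d) *:%R twist_in twist_in_linear.

Lemma twist_out_linear : linear twist_out.
Proof. by []. Qed.
HB.instance Definition _ :=
  GRing.isLinear.Build A (twist d) X *:%R twist_out twist_out_linear.

Definition twist_extension : extension X Y.
refine (@Extension K A X Y (twist d) twist_in twist_out _ _ _).
- by move=> y y' [].
- by move=> x; exists (0, x).
- move=> [y x]; split=> [/= ->|[y' [_ <-]] //]; by exists y.
Defined.

End Twist.

(** A splitting of the twisted extension has the form x |-> (u x, x); its A-linearity says exactly
    that [d] is the inner derivation of - u. *)
Lemma Ext1_zero_ext0 X Y : Ext1_zero X Y -> ext0 X Y.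
Proof.
move=> XY d; have [s sK] := XY (twist_extension d).
have sE x : s x = ((s x).1, x) :> twist d by move: (sK x); case: (s x) => y x' /= ->.
have tP (k : K) x y : - (s (k%:A *: x + y)).1 = k%:A *: - (s x).1 - (s y).1.
  rewrite linearP /= [s x in LHS]sE [s y in LHS]sE /= der_alg addr0.
  by rewrite opprD scalerN.
exists (HomK tP) => a x /=.
have := linearZ_LR s a x; rewrite [s x in RHS]sE => -> /=.
by rewrite opprK scalerN addKr.
Qed.

End KLinear.

(** * Bases of finite-dimensional modules and extension of homomorphisms *)

Section Bases.
Variables (K : fieldType) (A : algType K).
Implicit Types X Y M : lmodType A.

Record basis X n := Basis {
  bvec :> 'I_n -> X;
  coord : X -> 'I_n -> K;
  coordE : forall x, x = \sum_i (coord x i)%:A *: bvec i;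
  coord_linear : forall (k : K) x y i,
    coord (k%:A *: x + y) i = k * coord x i + coord y i
}.

(** A spanning family of minimal size is free, so coordinates picked by choice are unique and
    therefore linear. *)
Lemma fin_dim_basis X : fin_dim X -> exists n, inhabited (basis X n).
Proof.
move=> X_fin.
have ex_n : exists n, `[< exists e : 'I_n -> X, forall s : X,
    exists c : 'I_n -> K, s = \sum_(i < n) (c i)%:A *: e i >].
  by case: X_fin => n [e eP]; exists n; apply/asboolP; exists e.
case: (ex_minnP ex_n) => n /asboolP [e /choice [c cE]] n_min.
exists n.
have e_free (l : 'I_n -> K) : \sum_i (l i)%:A *: e i = 0 -> forall i, l i = 0.
  move=> l0 i; apply/eqP/negPn/negP => li_neq0.
  move: e c cE n_min l l0 i li_neq0; case: n => [|n] e c cE n_min l l0 i li_neq0.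
    by case: i {li_neq0}.
  suff /n_min : `[< exists e : 'I_n -> X, forall s : X,
    exists c : 'I_n -> K, s = \sum_(i < n) (c i)%:A *: e i >] by rewrite ltnn.
  apply/asboolP; exists (fun j => e (lift i j)) => s.
  (* Subtracting [c s i / l i] times the relation [l] removes the coefficient of [e i]. *)
  exists (fun j => c s (lift i j) - c s i / l i * l (lift i j)).
  have : s = \sum_j (c s j - c s i / l i * l j)%:A *: e j.
    have := scaler0 X (c s i / l i)%:A; rewrite -{1}l0 scaler_sumr => l0'.
    rewrite -[LHS]subr0 -{1}l0' {1}(cE s) -sumrB; apply: eq_bigr => j _.
    by rewrite scalerA -[_%:A * _%:A]scalerAl mul1r scalerA -scalerBl -scalerBl.
  by rewrite (bigD1_ord i) //= divfK // subrr !scale0r add0r.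
constructor; apply: (@Basis X n e c) => // k x y i.
apply/eqP; rewrite -subr_eq0; apply/eqP.
apply: (e_free (fun i => c (k%:A *: x + y) i - (k * c x i + c y i))) => {i}.
transitivity (\sum_i ((c (k%:A *: x + y) i)%:A *: e i -
    (k%:A *: ((c x i)%:A *: e i) + (c y i)%:A *: e i))).
  apply: eq_bigr => i _; rewrite scalerBl scalerBl scalerDl scalerDl.
  by rewrite scalerA -[k%:A * _]scalerAl mul1r scalerA.
by rewrite sumrB big_split /= -scaler_sumr -!cE subrr.
Qed.

Section Coord.
Variables (X : lmodType A) (n : nat) (e : basis X n).

Lemma coordD x y i : coord e (x + y) i = coord e x i + coord e y i.
Proof. by have := coord_linear e 1 x y i; rewrite !scale1r mul1r. Qed.

Lemma coord0 i : coord e 0 i = 0.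
Proof. by apply: (@addrI _ (coord e 0 i)); rewrite -coordD !addr0. Qed.

Lemma coordZ (k : K) x i : coord e (k%:A *: x) i = k * coord e x i.
Proof. by have := coord_linear e k x 0 i; rewrite coord0 !addr0. Qed.

Lemma coord_sum m (F : 'I_m -> X) i :
  coord e (\sum_j F j) i = \sum_j coord e (F j) i.
Proof.
exact: (big_morph (coord e ^~ i) (fun x y => coordD x y i) (coord0 i)).
Qed.

Lemma algD (k l : K) : (k + l)%:A = k%:A + l%:A :> A.
Proof. exact: scalerDl. Qed.

Lemma algM (k l : K) : (k * l)%:A = k%:A * l%:A :> A.
Proof. by rewrite -scalerAl mul1r scalerA. Qed.

Lemma homK_of_basis_proof (L : lmodType A) (v : 'I_n -> L) (k : K) x y :
  \sum_i (coord e (k%:A *: x + y) i)%:A *: v i =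
  k%:A *: (\sum_i (coord e x i)%:A *: v i) + \sum_i (coord e y i)%:A *: v i.
Proof.
rewrite scaler_sumr -big_split /=; apply: eq_bigr => i _.
by rewrite coord_linear algD algM scalerDl scalerA.
Qed.

Definition homK_of_basis (L : lmodType A) (v : 'I_n -> L) : homK X L :=
  HomK (homK_of_basis_proof v).

Lemma homK_lift (Y Z : lmodType A) (V : set Y) (q : Y -> Z) (f : homK X Z) :
  V 0 -> (forall a x y, V x -> V y -> V (a *: x + y)) ->
  (forall a x y, V x -> V y -> q (a *: x + y) = a *: q x + q y) ->
  (forall z, exists2 y, V y & q y = z) ->
  exists g : homK X Y, forall x, V (g x) /\ q (g x) = f x.
Proof.
move=> V0 VP qP q_surj.
have /choice [v vP] : forall i, exists v, V v /\ q v = f (e i).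
  by move=> i; have [y Vy qy] := q_surj (f (e i)); exists y.
exists (homK_of_basis v) => x; rewrite [in f x](coordE e x) homK_sum /=.
have q0 : q 0 = 0.
  by have := qP (-1) _ _ V0 V0; rewrite !scaleN1r !addNr.
elim/big_rec2: _ => [|i z y _ [Vy qy]]; first by rewrite q0.
have [Vvi qvi] := vP i.
by split; [exact: VP | rewrite qP // qvi homKZ qy].
Qed.

End Coord.

Definition submod M (V : set M) : Prop :=
  V 0 /\ forall a x y, V x -> V y -> V (a *: x + y).

(** A homomorphism on a submodule is encoded as a total function; its values outside [V] carry no
    information. *)
Definition linear_on M Y (V : set M) (g : M -> Y) : Prop :=
  forall a x y, V x -> V y -> g (a *: x + y) = a *: g x + g y.

Section SubmodTheory.
Variables (M : lmodType A) (V : set M).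
Hypothesis VP : submod V.

Lemma submod0 : V 0. Proof. by case: VP. Qed.
Lemma submodZ a x : V x -> V (a *: x).
Proof. by case: VP => V0 Vl Vx; rewrite -[a *: x]addr0; apply: Vl. Qed.
Lemma submodD x y : V x -> V y -> V (x + y).
Proof. by case: VP => V0 Vl Vx Vy; rewrite -[x]scale1r; apply: Vl. Qed.
Lemma submodN x : V x -> V (- x).
Proof. by rewrite -scaleN1r; apply: submodZ. Qed.
Lemma submodB x y : V x -> V y -> V (x - y).
Proof. by move=> Vx Vy; apply/submodD/submodN. Qed.
Lemma submodBK x y : V (x - y) -> V y -> V x.
Proof. by move=> Vxy Vy; rewrite -[x](subrK y); apply: submodD. Qed.
Lemma submod_sum n (F : 'I_n -> M) : (forall i, V (F i)) -> V (\sum_i F i).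
Proof. by move=> VF; elim/big_ind: _ => //; [case: VP | exact: submodD]. Qed.

Variables (Y : lmodType A) (g : M -> Y).
Hypothesis gP : linear_on V g.

Lemma linear_on0 : g 0 = 0.
Proof. by have := gP (-1) submod0 submod0; rewrite !scaleN1r !addNr. Qed.
Lemma linear_onZ a x : V x -> g (a *: x) = a *: g x.
Proof. by move=> Vx; rewrite -[_ *: x]addr0 gP ?linear_on0 ?addr0 //; case: VP. Qed.
Lemma linear_onD x y : V x -> V y -> g (x + y) = g x + g y.
Proof. by move=> Vx Vy; rewrite -[x]scale1r gP // !scale1r. Qed.
Lemma linear_onB x y : V x -> V y -> g (x - y) = g x - g y.
Proof.
move=> Vx Vy; rewrite -scaleN1r linear_onD //; last exact: submodZ.
by rewrite linear_onZ // scaleN1r.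
Qed.

Lemma submod_ker : submod [set x | V x /\ g x = 0].
Proof.
split=> [|a x y [Vx gx] [Vy gy]]; first by split; [case: VP | exact: linear_on0].
by split; [case: VP => _; apply | rewrite gP // gx gy scaler0 addr0].
Qed.

End SubmodTheory.

(** For a K-linear section s of q, pushing the class of the extension V of X along g gives the
    derivation g (a s(x) - s(a x)). If it is inner, given by t, then v |-> g (v - s(q v)) + t (q v)
    is A-linear and extends g. *)
Lemma ext0_extend X Y M n (e : basis X n) (V : set M) (q : M -> X) (g : M -> Y) :
  ext0 X Y -> submod V -> linear_on V q ->
  (forall x, exists2 v, V v & q v = x) ->
  linear_on [set v | V v /\ q v = 0] g ->
  exists G : M -> Y, linear_on V G /\ forall v, V v -> q v = 0 -> G v = g v.
Proof.
move=> XY VP qP q_surj gP; pose U : set M := [set v | V v /\ q v = 0]%classic.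
rewrite -/U in gP; have UP : submod U := submod_ker VP qP.
have [V0 Vl] := VP.
have [s sP] := homK_lift e (homK_of_linear idfun) V0 Vl qP q_surj.
have Vs x : V (s x) by have [] := sP x.
have qs x : q (s x) = x by have [] := sP x.
have Us a x : U (a *: s x - s (a *: x)).
  split; first by apply: submodB => //; exact: submodZ.
  by rewrite (linear_onB VP qP) ?(linear_onZ VP qP) ?qs ?subrr //; apply: submodZ.
have [d dE] : {d : derivation X Y |
    forall a x, d a x = g (a *: s x - s (a *: x))}.
  have Dl a b x : g ((a + b) *: s x - s ((a + b) *: x)) =
      g (a *: s x - s (a *: x)) + g (b *: s x - s (b *: x)).
    by rewrite -(linear_onD gP) // addrACA -opprD -homKD -!scalerDl.
  have Dr a x y : g (a *: s (x + y) - s (a *: (x + y))) =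
      g (a *: s x - s (a *: x)) + g (a *: s y - s (a *: y)).
    by rewrite -(linear_onD gP) // addrACA -opprD -homKD -!scalerDr -homKD.
  have Dm a b x : g ((a * b) *: s x - s ((a * b) *: x)) =
      a *: g (b *: s x - s (b *: x)) + g (a *: s (b *: x) - s (a *: (b *: x))).
    by rewrite -gP // scalerBr addrA subrK !scalerA.
  have Da (k : K) x : g (k%:A *: s x - s (k%:A *: x)) = 0.
    by rewrite homKZ subrr (linear_on0 UP gP).
  by exists (Derivation Dl Dr Dm Da).
have [t tP] := XY d.
have Uv v : V v -> U (v - s (q v)).
  move=> Vv; split; first by apply: submodB.
  by rewrite (linear_onB VP qP) // qs subrr.
exists (fun v => g (v - s (q v)) + t (q v)); split; last first.
  by move=> v Vv qv; rewrite qv !homK0 subr0 addr0.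
move=> a x y Vx Vy; rewrite qP // !homKD.
have -> : a *: x + y - (s (a *: q x) + s (q y)) =
   a *: (x - s (q x)) + ((a *: s (q x) - s (a *: q x)) + (y - s (q y))).
  by rewrite opprD scalerBr addrA -!addrA; congr (_ + _);
     rewrite addKr addrCA.
rewrite gP //; [|exact: Uv|by apply: submodD => //; apply: Uv].
rewrite (linear_onD gP (Us _ _) (Uv _ Vy)).
rewrite -dE tP scalerDr -!addrA; congr (_ + (_ + _)).
by rewrite [X in - _ + X]addrCA addKr.
Qed.

End Bases.

(** * Duality for finitely generated projective bimodules *)

Section RestrictScalars.
Variables (K : fieldType) (A : algType K).

Definition restrK (X : lmodType A) : Type := X.
HB.instance Definition _ X := GRing.Zmodule.on (restrK X).

Section Structure.
Variable X : lmodType A.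
Definition restrK_scale (k : K) (x : restrK X) : restrK X := k%:A *: (x : X).
Lemma restrK_scaleA k l x :
  restrK_scale k (restrK_scale l x) = restrK_scale (k * l) x.
Proof. by rewrite /restrK_scale scalerA algM. Qed.
Lemma restrK_scale1 : left_id 1 restrK_scale.
Proof. by move=> x; rewrite /restrK_scale scale1r scale1r. Qed.
Lemma restrK_scaleDr : right_distributive restrK_scale +%R.
Proof. by move=> k x y; rewrite /restrK_scale scalerDr. Qed.
Lemma restrK_scaleDl x : {morph restrK_scale^~ x : k l / k + l}.
Proof. by move=> k l; rewrite /restrK_scale scalerDl scalerDl. Qed.
HB.instance Definition _ := GRing.Zmodule_isLmodule.Build K (restrK X)
  restrK_scaleA restrK_scale1 restrK_scaleDr restrK_scaleDl.
Lemma restrK_scaleE k x : k *: (x : restrK X) = k%:A *: (x : X).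
Proof. by []. Qed.
End Structure.

End RestrictScalars.

Section TensorAction.
Variables (K : fieldType) (A : algType K).
Implicit Types M N : bimodule A.

Lemma ract_alg M (m : M) (k : K) (a : A) : ract m (k *: a) = k%:A *: ract m a.
Proof. by rewrite -(mulr_algl k a) ractM ract_central ract_lact. Qed.

Section Bilinear.
Variables (M : bimodule A) (m : M).

Definition sandwich (a b : A) : restrK M := a *: ract m b.
Lemma sandwich_bilinear : bilinear_for *:%R *:%R sandwich.
Proof.
split=> [b k a a'|a k b b']; rewrite /= /sandwich restrK_scaleE.
  by rewrite scalerDl scalerA mulr_algl.
by rewrite ractDr scalerDr algZC ract_alg.
Qed.
HB.instance Definition _ := bilinear_isBilinear.Build K A A (restrK M)
  *:%R *:%R sandwich sandwich_bilinear.

Definition osandwich (a b : A) : restrK M := b *: ract m a.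
Lemma osandwich_bilinear : bilinear_for *:%R *:%R osandwich.
Proof.
split=> [b k a a'|a k b b']; rewrite /= /osandwich restrK_scaleE.
  by rewrite ractDr scalerDr algZC ract_alg.
by rewrite scalerDl scalerA mulr_algl.
Qed.
HB.instance Definition _ := bilinear_isBilinear.Build K A A (restrK M)
  *:%R *:%R osandwich osandwich_bilinear.

(** [tact m] is the bimodule map from A (x) A with the outer structure that sends 1 (x) 1 to m.
    [otact] swaps the two factors and thereby matches the inner structure, which is the one acting
    on the dual. *)
Definition tact (t : tensAA A) : M := tens_lift sandwich t.
Definition otact (t : tensAA A) : M := tens_lift osandwich t.

Lemma tact_tens a b : tact (tens a b) = a *: ract m b.
Proof. by rewrite /tact /otact tens_lift_tens. Qed.
Lemma tactDl : {morph tact : t u / t + u}.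
Proof. by move=> t u; rewrite /tact /otact tens_liftD. Qed.
Lemma tact0l : tact 0 = 0.
Proof. by apply: (@addrI _ (tact 0)); rewrite -tactDl !addr0. Qed.
Lemma otact_tens a b : otact (tens a b) = b *: ract m a.
Proof. by rewrite /tact /otact tens_lift_tens. Qed.
Lemma otactDl : {morph otact : t u / t + u}.
Proof. by move=> t u; rewrite /tact /otact tens_liftD. Qed.
Lemma otact0l : otact 0 = 0.
Proof. by apply: (@addrI _ (otact 0)); rewrite -otactDl !addr0. Qed.

Lemma outer_tens (a x y : A) : a *: (tens x y : tensAA A) = tens (a * x) y.
Proof. exact: tens_map_tens. Qed.

Lemma tactZ a t : tact (a *: t) = a *: tact t.
Proof.
elim/tens_ind: t => [|x y t IH]; first by rewrite scaler0 tact0l scaler0.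
by rewrite scalerDr !tactDl IH outer_tens !tact_tens scalerDr scalerA.
Qed.

Lemma tact_outer_r a t : tact (outer_r a t) = ract (tact t) a.
Proof.
elim/tens_ind: t => [|x y t IH].
  by rewrite tact0l ract0 -[X in tact X]/(ract (0 : bimod_tensAA A) a) ract0 tact0l.
rewrite /outer_r tens_mapD -/(outer_r a t) !tactDl IH ractDl; congr (_ + _).
by rewrite /outer_r tens_map_tens !tact_tens -ract_lact -ract_lact -ractM.
Qed.

End Bilinear.

Lemma tact0r M t : tact (0 : M) t = 0.
Proof.
elim/tens_ind: t => [|x y t IH]; first by rewrite tact0l.
by rewrite tactDl IH tact_tens ract0 scaler0 addr0.
Qed.

Lemma tactDr M t : {morph (fun m : M => tact m t) : m n / m + n}.
Proof.
move=> m n /=; elim/tens_ind: t => [|x y t IH]; first by rewrite !tact0l addr0.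
by rewrite !tactDl IH !tact_tens ractDl scalerDr addrACA.
Qed.

Lemma tact_algr M (m : M) (k : K) t : tact (k%:A *: m) t = k%:A *: tact m t.
Proof.
elim/tens_ind: t => [|x y t IH]; first by rewrite !tact0l scaler0.
by rewrite !tactDl IH !tact_tens ract_lact scalerDr -algZC.
Qed.

Lemma bihomN M N (f : bihom M N) x : f (- x) = - f x.
Proof. by rewrite -scaleN1r bihomZ scaleN1r. Qed.

Lemma bihomB M N (f : bihom M N) x y : f (x - y) = f x - f y.
Proof. by rewrite bihomD bihomN. Qed.

Lemma bihom_tact M N (f : bihom M N) m t : f (tact m t) = tact (f m) t.
Proof.
elim/tens_ind: t => [|x y t IH]; first by rewrite !tact0l bihom0.
by rewrite !tactDl bihomD IH !tact_tens bihomZ bihom_ract.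
Qed.

Lemma bihom_otact M N (f : bihom M N) m t : f (otact m t) = otact (f m) t.
Proof.
elim/tens_ind: t => [|x y t IH]; first by rewrite !otact0l bihom0.
by rewrite !otactDl bihomD IH !otact_tens bihomZ bihom_ract.
Qed.

Lemma inner_l0 (a : A) : inner_l a 0 = 0.
Proof. by apply: (@addrI _ (inner_l a 0)); rewrite -tens_mapD !addr0. Qed.
Lemma inner_r0 (a : A) : inner_r a 0 = 0.
Proof. by apply: (@addrI _ (inner_r a 0)); rewrite -tens_mapD !addr0. Qed.

Lemma tact_inner_l M (m : M) a t : tact m (inner_l a t) = tact (ract m a) t.
Proof.
elim/tens_ind: t => [|x y t IH]; first by rewrite inner_l0 !tact0l.
rewrite /inner_l tens_mapD -/(inner_l a t) !tactDl IH; congr (_ + _).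
by rewrite tens_map_tens !tact_tens ractM.
Qed.

Lemma tact_inner_r M (m : M) a t : tact m (inner_r a t) = tact (a *: m) t.
Proof.
elim/tens_ind: t => [|x y t IH]; first by rewrite inner_r0 !tact0l.
rewrite /inner_r tens_mapD -/(inner_r a t) !tactDl IH; congr (_ + _).
by rewrite tens_map_tens !tact_tens ract_lact scalerA.
Qed.

Lemma otact_inner_l M (m : M) a t : otact m (inner_l a t) = a *: otact m t.
Proof.
elim/tens_ind: t => [|x y t IH]; first by rewrite inner_l0 !otact0l scaler0.
rewrite /inner_l tens_mapD -/(inner_l a t) !otactDl IH scalerDr; congr (_ + _).
by rewrite tens_map_tens !otact_tens scalerA.
Qed.

Lemma otact_inner_r M (m : M) a t : otact m (inner_r a t) = ract (otact m t) a.
Proof.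
elim/tens_ind: t => [|x y t IH]; first by rewrite inner_r0 !otact0l ract0.
rewrite /inner_r tens_mapD -/(inner_r a t) !otactDl IH ractDl; congr (_ + _).
by rewrite tens_map_tens !otact_tens ract_lact ractM.
Qed.

Section Dual.
Variable P : bimodule A.

(** For s = a (x) b and phi x = y (x) z, both sides are y a (x) b z. *)
Lemma otact_dual (phi : bimod_dual P) s x :
  (otact phi s : dual P) x = tact (s : bimod_tensAA A) ((phi : dual P) x).
Proof.
elim/tens_ind: s => [|a b s IH]; first by rewrite otact0l tact0r.
rewrite otactDl tactDr -IH /=; congr (_ + _).
rewrite otact_tens /=; elim/tens_ind: ((phi : dual P) x) => [|y z t {}IH].
  by rewrite tact0l inner_r0 inner_l0.
rewrite tactDl -IH /inner_r tens_mapD /inner_l tens_mapD; congr (_ + _).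
by rewrite !tens_map_tens tact_tens /= /outer_r tens_map_tens outer_tens.
Qed.

Definition dual_ev (M : bimodule A) (phi : dual P) (m : M) : bihom P M.
refine (@Bihom K A P M (fun x => tact m (phi x)) _ _).
- by move=> a x y; rewrite bihom_linear tactDl tactZ.
- by move=> x a; rewrite bihom_ract tact_outer_r.
Defined.

Definition dual_basis r (p : 'I_r -> P) (phi : 'I_r -> dual P) : Prop :=
  forall x, x = \sum_j tact (p j) (phi j x).

Lemma dual_sum_eval r (F : 'I_r -> dual P) x : (\sum_j F j) x = \sum_j F j x.
Proof. by elim/big_rec2: _ => //= j f g _ <-. Qed.

Lemma bihom_sum (M N : bimodule A) (f : bihom M N) r (F : 'I_r -> M) :
  f (\sum_j F j) = \sum_j f (F j).
Proof. exact: (big_morph f (bihomD f) (bihom0 f)). Qed.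

Lemma dual_basis_dual r p phi : @dual_basis r p phi ->
  forall f : bimod_dual P, f = \sum_j otact (phi j : bimod_dual P) ((f : dual P) (p j)).
Proof.
move=> pP f; apply: bihomP => x; rewrite dual_sum_eval [in LHS](pP x) bihom_sum.
by apply: eq_bigr => j _; rewrite otact_dual bihom_tact.
Qed.

Lemma dual_basis_bihom r p phi (M : bimodule A) (f : bihom P M) :
  @dual_basis r p phi -> forall x, f x = \sum_j tact (f (p j)) (phi j x).
Proof.
move=> pP x; rewrite [in LHS](pP x) bihom_sum; apply: eq_bigr => j _.
exact: bihom_tact.
Qed.

(** Projectivity of the dual: the [phi j] generate it, and lifts m_j of f (phi_j) define the map u
    |-> sum_j [otact] m_j (u (p_j)). Only the image of f has to lie in the image of q. *)
Lemma dual_lift r p phi (M N : bimodule A) (q : bihom M N)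
    (f : bihom (bimod_dual P) N) :
  @dual_basis r p phi -> (forall u, exists x, q x = f u) ->
  exists h : bihom (bimod_dual P) M, forall u, q (h u) = f u.
Proof.
move=> pP q_surj.
have /choice [m mP] j := q_surj (phi j).
have gl : linear (fun u : bimod_dual P => \sum_j otact (m j) ((u : dual P) (p j))).
  move=> a u v; rewrite scaler_sumr -big_split; apply: eq_bigr => j _ /=.
  by rewrite otactDl otact_inner_l.
have gr (u : bimod_dual P) a : \sum_j otact (m j) ((ract u a : dual P) (p j)) =
    ract (\sum_j otact (m j) ((u : dual P) (p j))) a.
  rewrite (big_morph (fun x => ract x a) (fun x y => ractDl x y a) (ract0 M a)).
  by apply: eq_bigr => j _; rewrite otact_inner_r.
exists (Bihom gl gr) => u /=.
rewrite [in RHS](dual_basis_dual pP u) !bihom_sum; apply: eq_bigr => j _.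
by rewrite !bihom_otact mP.
Qed.

End Dual.

Section Power.
Variables (M : bimodule A) (n : nat).

Definition bimod_pow : bimodule A.
refine (@Bimodule K A {ffun 'I_n -> M} (fun x a => [ffun i => ract (x i) a])
  _ _ _ _ _ _).
- by move=> x y a; apply/ffunP => i; rewrite !ffunE ractDl.
- by move=> x a b; apply/ffunP => i; rewrite !ffunE ractDr.
- by move=> x; apply/ffunP => i; rewrite !ffunE ract1.
- by move=> x a b; apply/ffunP => i; rewrite !ffunE ractM.
- by move=> a x b; apply/ffunP => i; rewrite !ffunE ract_lact.
- by move=> x k; apply/ffunP => i; rewrite !ffunE ract_central.
Defined.

End Power.

(** A projective module splits the surjection from a power of A (x) A given by generators; the
    coordinates of the splitting are the dual basis. *)
Lemma fg_projective_dual_basis (P : bimodule A) :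
  bimod_fg P -> bimod_projective P ->
  exists r p phi, @dual_basis P r p phi.
Proof.
move=> [r [p pP]] Pproj; exists r, p.
have fl : linear (fun u : bimod_pow (bimod_tensAA A) r => \sum_j tact (p j) (u j)).
  move=> a u v; rewrite scaler_sumr -big_split; apply: eq_bigr => j _ /=.
  by rewrite !ffunE tactDl tactZ.
have fr (u : bimod_pow (bimod_tensAA A) r) a :
    \sum_j tact (p j) ((ract u a : bimod_pow _ _) j) = ract (\sum_j tact (p j) (u j)) a.
  rewrite (big_morph (fun x => ract x a) (fun x y => ractDl x y a) (ract0 P a)).
  by apply: eq_bigr => j _; rewrite ffunE tact_outer_r.
have idl : linear (fun x : P => x) by [].
have idr (x : P) (a : A) : ract x a = ract x a by [].
have [|s sP] := Pproj _ P (Bihom fl fr) (Bihom idl idr).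
  move=> x; have [m [a [b [k ->]]]] := pP x.
  exists (\sum_(i < m) ([ffun j => if j == k i then tens (a i) (b i) else 0]
     : bimod_pow (bimod_tensAA A) r)).
  rewrite bihom_sum; apply: eq_bigr => i _ /=.
  rewrite (bigD1 (k i)) //= ffunE eqxx tact_tens ract_lact big1 ?addr0 //.
  by move=> j /negPf kj; rewrite ffunE kj tact0l.
have phil j : linear (fun x => (s x : {ffun 'I_r -> bimod_tensAA A}) j).
  by move=> a x y; rewrite bihom_linear !ffunE.
have phir j x a : (s (ract x a) : {ffun 'I_r -> bimod_tensAA A}) j = ract (s x j) a.
  by rewrite bihom_ract ffunE.
exists (fun j => Bihom (phil j) (phir j)) => x.
exact: (esym (sP x)).
Qed.

End TensorAction.

(** Stated for bare types with an operation k x + y, so that it applies to sets of bimodule maps. By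
    induction on the list, a factorization mu exists where b_i h vanishes, and a multiple of b_i
    corrects it elsewhere. *)
Lemma factor_functional (K : fieldType) (T1 T2 : Type)
    (comb1 : K -> T1 -> T1 -> T1) (comb2 : K -> T2 -> T2 -> T2)
    (h : T1 -> T2) (alpha : T1 -> K) (I : eqType) (b : I -> T2 -> K) (s : seq I) :
  (forall k x y, h (comb1 k x y) = comb2 k (h x) (h y)) ->
  (forall k x y, alpha (comb1 k x y) = k * alpha x + alpha y) ->
  (forall i k x y, b i (comb2 k x y) = k * b i x + b i y) ->
  (forall x, (forall i, i \in s -> b i (h x) = 0) -> alpha x = 0) ->
  exists mu : T2 -> K, (forall k x y, mu (comb2 k x y) = k * mu x + mu y) /\
    forall x, alpha x = mu (h x).
Proof.
move=> hP aP bP.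
suff gen (D : T1 -> Prop) : (forall k x y, D x -> D y -> D (comb1 k x y)) ->
    (forall x, D x -> (forall i, i \in s -> b i (h x) = 0) -> alpha x = 0) ->
    exists mu : T2 -> K, (forall k x y, mu (comb2 k x y) = k * mu x + mu y) /\
      forall x, D x -> alpha x = mu (h x).
  move=> a0; have [||mu [muP muE]] := gen (fun=> True) => //.
    by move=> x _; apply: a0.
  by exists mu; split=> // x; apply: muE.
elim: s D => [|i s IH] D DP a0.
  by exists (fun=> 0); split=> [k x y|x Dx]; rewrite ?mulr0 ?addr0 // a0.
have [||mu [muP muE]] := IH (fun x => D x /\ b i (h x) = 0).
- move=> k x y [Dx bx] [Dy bY]; split; first exact: DP.
  by rewrite hP bP bx bY mulr0 addr0.
- move=> x [Dx bx] bs; apply: a0 => // j; rewrite inE => /predU1P[-> //|]; exact: bs.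
have [[x0 [Dx0 /eqP bx0]]|all0] := pselect (exists x, D x /\ b i (h x) <> 0);
    last first.
  exists mu; split=> // x Dx; apply: muE; split=> //.
  by apply: contrapT => bx; apply: all0; exists x.
(* Chosen so that mu + c b_i takes the right value at x0; any other x becomes a zero of b_i h after
   subtracting a multiple of x0. *)
pose c := (alpha x0 - mu (h x0)) / b i (h x0).
exists (fun y => mu y + c * b i y); split=> [k x y|x Dx].
  by rewrite muP bP mulrDr mulrCA mulrDr addrACA.
have := muE (comb1 (- (b i (h x) / b i (h x0))) x0 x).
rewrite aP hP muP bP mulNr divfK // addNr => /(_ (conj (DP _ _ _ Dx0 Dx) erefl)).
rewrite mulNr addrC => /eqP; rewrite subr_eq => /eqP ->.
by rewrite /c; ring.
Qed.

Section Trace.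
Variables (K : fieldType) (A : algType K).
Variables (X Y : lmodType A) (n : nat) (e : basis X n).
Implicit Types (f : homK X Y) (g : homK Y X).

Definition trace_pair f g : K := \sum_i coord e (g (f (e i))) i.

Lemma trace_pair_linear (k : K) f f' g :
  trace_pair (k%:A *: f + f') g = k * trace_pair f g + trace_pair f' g.
Proof.
rewrite /trace_pair mulr_sumr -big_split /=; apply: eq_bigr => i _.
by rewrite homK_linear coord_linear.
Qed.

(** Cyclicity of the trace. *)
Lemma trace_pair_ract (a : A) f g :
  trace_pair (homK_ract f a) g = trace_pair f (a *: g).
Proof.
rewrite /trace_pair /=.
transitivity (\sum_i \sum_j coord e (a *: e i) j * coord e (g (f (e j))) i).
  apply: eq_bigr => i _; rewrite [in LHS](coordE e (a *: e i)) !homK_sum coord_sum.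
  by apply: eq_bigr => j _; rewrite !homKZ coordZ.
rewrite exchange_big /=; apply: eq_bigr => j _.
rewrite [in RHS](coordE e (g (f (e j)))) scaler_sumr coord_sum.
by apply: eq_bigr => i _; rewrite -algZC coordZ mulrC.
Qed.

Definition rank1 (i : 'I_n) (y : Y) : homK X Y.
refine (@HomK K A X Y (fun x => (coord e x i)%:A *: y) _).
by move=> k x x'; rewrite coord_linear algD algM scalerDl scalerA.
Defined.

Lemma trace_pair_rank1 i y g : trace_pair (rank1 i y) g = coord e (g y) i.
Proof.
rewrite [in RHS](coordE e (g y)) coord_sum; apply: eq_bigr => j _.
by rewrite homKZ !coordZ mulrC.
Qed.

Lemma trace_pair_inj g g' :
  (forall f, trace_pair f g = trace_pair f g') -> g = g'.
Proof.
move=> gg'; apply: homKP => y; rewrite (coordE e (g y)) (coordE e (g' y)).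
by apply: eq_bigr => i _; rewrite -!trace_pair_rank1 gg'.
Qed.

(** Every f is the sum of the maps [rank1 i (f (e i))], so mu is determined by its values on
    rank-one maps, and these values are the coordinates of g. *)
Lemma trace_pair_represent (mu : homK X Y -> K) :
  (forall (k : K) f f', mu (k%:A *: f + f') = k * mu f + mu f') ->
  exists g, forall f, trace_pair f g = mu f.
Proof.
move=> muP; have mu0 : mu 0 = 0.
  by have := muP (-1) 0 0; rewrite scaler0 addr0 mulN1r addNr.
have nuP i (k : K) y y' :
    mu (rank1 i (k%:A *: y + y')) = k * mu (rank1 i y) + mu (rank1 i y').
  by rewrite -muP; congr mu; apply: homKP => x /=; rewrite scalerDr algZC.
have gP (k : K) y y' : \sum_i (mu (rank1 i (k%:A *: y + y')))%:A *: e i =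
    k%:A *: (\sum_i (mu (rank1 i y))%:A *: e i) + \sum_i (mu (rank1 i y'))%:A *: e i.
  rewrite scaler_sumr -big_split /=; apply: eq_bigr => i _.
  by rewrite scalerA -algM -scalerDl -algD nuP.
exists (HomK gP) => f; rewrite /trace_pair /=.
have nu0 i : mu (rank1 i 0) = 0.
  by rewrite -[RHS]mu0; congr mu; apply: homKP => x /=; rewrite scaler0.
have muD u v : mu (u + v) = mu u + mu v.
  by have := muP 1 u v; rewrite !scale1r mul1r.
have nuD i y y' : mu (rank1 i (y + y')) = mu (rank1 i y) + mu (rank1 i y').
  by have := nuP i 1 y y'; rewrite !scale1r mul1r.
have {2}-> : f = \sum_i rank1 i (f (e i)).
  apply: homKP => x; rewrite [in LHS](coordE e x) homK_sum.
  have sumE m (F : 'I_m -> homK X Y) : (\sum_i F i) x = \sum_i F i x.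
    by elim/big_rec2: _ => //= i u v _ <-.
  by rewrite sumE; apply: eq_bigr => i _; rewrite homKZ.
rewrite (big_morph mu muD mu0).
transitivity (\sum_j \sum_i coord e (e i) j * mu (rank1 i (f (e j)))).
  apply: eq_bigr => j _; rewrite coord_sum; apply: eq_bigr => i _.
  by rewrite coordZ mulrC.
rewrite exchange_big /=; apply: eq_bigr => i _.
rewrite [in RHS](coordE e (e i)) homK_sum.
rewrite (big_morph (fun y => mu (rank1 i y)) (nuD i) (nu0 i)).
apply: eq_bigr => j _; rewrite homKZ.
by have := nuP i (coord e (e i) j) (f (e j)) 0; rewrite nu0 !addr0.
Qed.

End Trace.

Section Duality.
Variables (K : fieldType) (A : algType K).
Implicit Types P M : bimodule A.

Definition bihom_comb P M (k : K) (f g : bihom P M) : bihom P M.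
refine (@Bihom K A P M (fun x => k%:A *: f x + g x) _ _).
- by move=> a x y; rewrite !bihom_linear !scalerDr algZC addrACA.
- by move=> x a; rewrite !bihom_ract ractDl ract_lact.
Defined.

Section Pairing.
Variables (X Y : lmodType A) (n m : nat) (e : basis X n) (e' : basis Y m).

Lemma trace_pairDr (f : homK X Y) (g g' : homK Y X) :
  trace_pair e f (g + g') = trace_pair e f g + trace_pair e f g'.
Proof.
by rewrite /trace_pair -big_split; apply: eq_bigr => i _; apply: coordD.
Qed.

Lemma trace_pairDl (f f' : homK X Y) (g : homK Y X) :
  trace_pair e (f + f') g = trace_pair e f g + trace_pair e f' g.
Proof. by have := trace_pair_linear e 1 f f' g; rewrite !scale1r mul1r. Qed.

Lemma trace_pair0l g : trace_pair e (0 : homK X Y) g = 0.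
Proof. by apply: (@addrI _ (trace_pair e 0 g)); rewrite -trace_pairDl !addr0. Qed.

Lemma trace_pair0r f : trace_pair e f (0 : homK Y X) = 0.
Proof. by apply: (@addrI _ (trace_pair e f 0)); rewrite -trace_pairDr !addr0. Qed.

Lemma trace_pair_tact (f : bimod_homK X Y) (g : bimod_homK Y X) t :
  trace_pair e (tact f t) g = trace_pair e f (otact g t).
Proof.
elim/tens_ind: t => [|a b t IH].
  by rewrite tact0l otact0l trace_pair0l trace_pair0r.
rewrite tactDl otactDl trace_pairDl trace_pairDr IH tact_tens otact_tens.
by congr (_ + _); rewrite -trace_pair_ract.
Qed.

Variables (P0 P1 P2 : bimodule A) (d1 : bihom P1 P0) (d2 : bihom P2 P1).
Variables (r0 : nat) (q : 'I_r0 -> P0) (psi : 'I_r0 -> dual P0).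
Variables (r1 : nat) (p : 'I_r1 -> P1) (phi : 'I_r1 -> dual P1).
Variables (r2 : nat) (s : 'I_r2 -> P2) (chi : 'I_r2 -> dual P2).
Hypotheses (qP : dual_basis q psi) (pP : dual_basis p phi) (sP : dual_basis s chi).

(* For finitely generated projective P, Hom(P^v, Hom_K(Y, X)) is the K-dual   *)
(* of Hom(P, Hom_K(X, Y)), so exactness passes from one side to the other.    *)
Lemma dual_exact :
  (forall f : bihom P1 (bimod_homK X Y), (forall x, f (d2 x) = 0) ->
     exists g : bihom P0 (bimod_homK X Y), forall x, f x = g (d1 x)) ->
  forall u : bihom (bimod_dual P1) (bimod_homK Y X),
    (forall w : bimod_dual P0, u (dual_map d1 w) = 0) ->
    exists v : bihom (bimod_dual P2) (bimod_homK Y X),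
      forall w : bimod_dual P1, u w = v (dual_map d2 w).
Proof.
move=> exH u u0.
(* The functional on Hom(P1, Hom_K(X, Y)) that corresponds to u under the trace form. *)
pose lam (f : bihom P1 (bimod_homK X Y)) : K :=
  \sum_j trace_pair e (f (p j)) (u (phi j : bimod_dual P1)).
have lam_ev (w : bimod_dual P1) f : lam (dual_ev w f) = trace_pair e f (u w).
  rewrite [in RHS](dual_basis_dual pP w) bihom_sum.
  rewrite (big_morph _ (trace_pairDr f) (trace_pair0r f)).
  by apply: eq_bigr => j _; rewrite bihom_otact -trace_pair_tact.
(* Here f = g d1, and [lam] pairs g d1 through u composed with the dual of d1, which is zero. *)
have lam0 (f : bihom P1 (bimod_homK X Y)) : (forall x, f (d2 x) = 0) -> lam f = 0.
  move=> /exH [g gE]; rewrite /lam.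
  transitivity (\sum_j \sum_k
      trace_pair e (tact (g (q k)) (psi k (d1 (p j)))) (u (phi j : bimod_dual P1))).
    apply: eq_bigr => j _; rewrite gE (dual_basis_bihom g qP).
    exact: (big_morph (fun f => trace_pair e f _) (fun x y => trace_pairDl x y _)
      (trace_pair0l _)).
  rewrite exchange_big big1 //= => k _.
  by rewrite -[LHS]/(lam (dual_ev (dual_map d1 (psi k : bimod_dual P0)) (g (q k))))
     lam_ev u0 trace_pair0r.
(* Coordinates of the values on the generators [s j]: finitely many functionals that together
   separate the maps on P2, so [lam] factors through composition with d2. *)
pose b (i : 'I_r2 * 'I_n * 'I_m) (f : bihom P2 (bimod_homK X Y)) : K :=
  coord e' ((f (s i.1.1) : homK X Y) (e i.1.2)) i.2.
have [||||mu [muP muE]] := @factor_functional K _ _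
  (@bihom_comb P1 (bimod_homK X Y)) (@bihom_comb P2 (bimod_homK X Y))
  (fun f => bihom_comp f d2) lam _ b (enum [set: 'I_r2 * 'I_n * 'I_m]%SET).
- by move=> k f g; apply: bihomP.
- move=> k f g; rewrite /lam mulr_sumr -big_split; apply: eq_bigr => j _ /=.
  exact: trace_pair_linear.
- by move=> i k f g; rewrite /b /= coord_linear.
- move=> f bf; apply: lam0 => x; rewrite -[LHS]/(bihom_comp f d2 x).
  rewrite (dual_basis_bihom _ sP) big1 // => j _.
  suff -> : bihom_comp f d2 (s j) = 0 by rewrite tact0r.
  apply: homKP => y; rewrite [in LHS](coordE e y) homK_sum big1 // => i _.
  rewrite homKZ (coordE e' (_ (e i))) big1 ?scaler0 // => l _.
  have := bf (j, i, l); rewrite mem_enum inE => /(_ isT); rewrite /b /= => ->.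
  by rewrite scale0r scale0r.
(* For fixed w, mu of [dual_ev w f] is a linear functional of f; v w represents it under the trace
   form. *)
have /choice [v vP] : forall w : bimod_dual P2, exists g : homK Y X,
    forall f : bimod_homK X Y, trace_pair e f g = mu (dual_ev w f).
  move=> w; apply: trace_pair_represent => k f f'; rewrite -muP; congr mu.
  by apply: bihomP => x; rewrite /= tactDr tact_algr.
have vl : linear (v : bimod_dual P2 -> bimod_homK Y X).
  move=> a w w'; apply: (trace_pair_inj (e := e)) => f.
  rewrite vP trace_pairDr -trace_pair_ract !vP.
  have := muP 1 (dual_ev w (homK_ract f a : bimod_homK X Y))
    (dual_ev w' (f : bimod_homK X Y)).
  rewrite mul1r => <-; congr mu; apply: bihomP => x /=.
  by rewrite !scale1r tactDl tact_inner_l.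
have vr (w : bimod_dual P2) a :
    v (ract w a) = ract (v w : bimod_homK Y X) a.
  apply: (trace_pair_inj (e := e)) => f.
  rewrite vP -[RHS]/(trace_pair e (homK_lact a f) (v w)) vP.
  by congr mu; apply: bihomP => x /=; rewrite tact_inner_r.
exists (Bihom vl vr) => w; apply: (trace_pair_inj (e := e)) => f.
rewrite -lam_ev muE /= vP; congr mu; exact: bihomP.
Qed.

End Pairing.
End Duality.

(** * Symmetry of the vanishing of Ext^1 *)

Section CalabiYau.
Variables (K : fieldType) (A : algType K).

(* The part of a finite resolution P and of an isomorphism                    *)
(* RHom(A, A (x) A) = A[-2] that is used: H^2 of the dual complex is A, hence *)
(* the class mapped to 1 by cy_rho is central up to coboundaries.             *)
Record cy2_data := CY2Data {
  cy_P0 : bimodule A; cy_P1 : bimodule A; cy_P2 : bimodule A;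
  cy_d1 : bihom cy_P1 cy_P0;
  cy_d2 : bihom cy_P2 cy_P1;
  cy_eps : bihom cy_P0 (bimod_reg A);
  cy_rho : bihom (bimod_dual cy_P2) (bimod_reg A);
  cy_fgproj0 : bimod_fg cy_P0 /\ bimod_projective cy_P0;
  cy_fgproj1 : bimod_fg cy_P1 /\ bimod_projective cy_P1;
  cy_fgproj2 : bimod_fg cy_P2 /\ bimod_projective cy_P2;
  cy_dd : forall x, cy_d1 (cy_d2 x) = 0;
  cy_epsd : forall x, cy_eps (cy_d1 x) = 0;
  cy_exact1 : forall x, cy_d1 x = 0 -> exists y, cy_d2 y = x;
  cy_exact0 : forall x, cy_eps x = 0 -> exists y, cy_d1 y = x;
  cy_eps_surj : exists x, cy_eps x = 1;
  cy_rhod : forall w, cy_rho (dual_map cy_d2 w) = 0;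
  cy_fundamental : exists2 w, cy_rho w = 1 &
    forall a, exists v, a *: w - ract w a = dual_map cy_d2 v
}.

Variable D : cy2_data.
Implicit Types X Y : lmodType A.

Local Notation d1 := (cy_d1 D).
Local Notation d2 := (cy_d2 D).
Local Notation eps := (cy_eps D).

Definition homK_comp (X Y Z : lmodType A) (g : homK Y Z) (f : homK X Y) :
  homK X Z.
refine (@HomK K A X Z (fun x => g (f x)) _).
by move=> k x y; rewrite !homK_linear.
Defined.

Definition homK_post (X Y Z : lmodType A) (g : {linear Y -> Z}) :
  bihom (bimod_homK X Y) (bimod_homK X Z).
refine (@Bihom K A (bimod_homK X Y) (bimod_homK X Z)
  (homK_comp (homK_of_linear g)) _ _).
- by move=> a t u; apply: homKP => x /=; rewrite linearP.
- by move=> t a; apply: homKP.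
Defined.

Definition homK_scale (X : lmodType A) (a : A) : homK X X.
refine (@HomK K A X X (fun x => a *: x) _).
by move=> k x y; rewrite scalerDr algZC.
Defined.

Definition homK_act (X : lmodType A) : bihom (bimod_reg A) (bimod_homK X X).
refine (@Bihom K A (bimod_reg A) (bimod_homK X X) (@homK_scale X) _ _).
- by move=> a b c; apply: homKP => x /=; rewrite scalerDl -scalerA.
- by move=> a b; apply: homKP => x /=; rewrite -scalerA.
Defined.

(** Since f kills the image of d2, it induces a map fb on ker eps. With eps p = 1, the elements a p
    - p a lie in ker eps and fb turns them into a derivation. If this is inner, given by t, then fb
    extends to P0 by sending p to t. *)
Lemma ext0_bimod_exact X Y : ext0 X Y ->
  forall f : bihom (cy_P1 D) (bimod_homK X Y), (forall x, f (d2 x) = 0) ->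
  exists g : bihom (cy_P0 D) (bimod_homK X Y), forall x, f x = g (d1 x).
Proof.
move=> XY f f0.
have f_eq x y : d1 x = d1 y -> f x = f y.
  move=> xy; have [|z zE] := @cy_exact1 D (x - y).
    by rewrite bihomB xy subrr.
  by have := f0 z; rewrite zE bihomB => /eqP;
    rewrite subr_eq0 => /eqP.
have /choice [fb fbP] : forall x, exists z : homK X Y,
    eps x = 0 -> forall y, d1 y = x -> f y = z.
  move=> x; have [/cy_exact0 [y <-]|x0] := pselect (eps x = 0); last by exists 0.
  by exists (f y) => _ z /f_eq.
have fbE y : fb (d1 y) = f y by rewrite -(fbP _ (cy_epsd y) y).
have fbD x y : eps x = 0 -> eps y = 0 -> fb (x + y) = fb x + fb y.
  by move=> /cy_exact0 [x' <-] /cy_exact0 [y' <-]; rewrite -bihomD !fbE bihomD.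
have fbZ a x : eps x = 0 -> fb (a *: x) = a *: fb x.
  by move=> /cy_exact0 [x' <-]; rewrite -bihomZ !fbE bihomZ.
have fbR a x : eps x = 0 -> fb (ract x a) = homK_ract (fb x) a.
  by move=> /cy_exact0 [x' <-]; rewrite -bihom_ract !fbE bihom_ract.
have epsB x y : eps (x - y) = eps x - eps y by apply: bihomB.
have [p p1] := cy_eps_surj D.
have epsaZ (a : A) x : eps (a *: x) = a * (eps x : A) by rewrite bihomZ.
have epsaR (a : A) x : eps (ract x a) = (eps x : A) * a by rewrite bihom_ract.
pose c (a : A) := a *: p - ract p a.
have ceps a : eps (c a) = 0.
  by rewrite epsB epsaZ epsaR p1 mulr1 mul1r subrr.
have cM a b : c (a * b) = a *: c b + ract (c a) b.
  rewrite /c scalerBr ractDl ractN ractM ract_lact scalerA addrA.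
  by rewrite subrK.
have [d dE] : {d : derivation X Y | forall a x, d a x = fb (c a) x}.
  have Dl a b x : fb (c (a + b)) x = fb (c a) x + fb (c b) x.
    have -> : c (a + b) = c a + c b.
      by rewrite /c scalerDl ractDr opprD addrACA.
    by rewrite fbD.
  have Dr a x y : fb (c a) (x + y) = fb (c a) x + fb (c a) y by rewrite homKD.
  have Dm a b x : fb (c (a * b)) x = a *: fb (c b) x + fb (c a) (b *: x).
    rewrite cM fbD ?fbZ ?fbR //; first by rewrite epsaZ ceps mulr0.
    by rewrite epsaR ceps mul0r.
  have Da (k : K) x : fb (c k%:A) x = 0.
    by rewrite /c ract_central subrr -(bihom0 d1) fbE bihom0.
  by exists (Derivation Dl Dr Dm Da).
have [t tP] := XY d.
have u0 x : eps (x - (eps x : A) *: p) = 0.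
  by rewrite epsB epsaZ p1 mulr1 subrr.
have gl : linear (fun x => fb (x - (eps x : A) *: p) + (eps x : A) *: t : bimod_homK X Y).
  move=> a x y; rewrite bihomD bihomZ.
  have -> : a *: x + y - ((a *: eps x + eps y : bimod_reg A) : A) *: p =
      a *: (x - (eps x : A) *: p) + (y - (eps y : A) *: p).
    by rewrite scalerBr scalerDl opprD addrACA scalerA.
  rewrite fbD ?fbZ ?epsaZ ?u0 ?mulr0 // scalerDr scalerDl -scalerA.
  by rewrite addrACA.
have gr x a : fb (ract x a - (eps (ract x a) : A) *: p) + (eps (ract x a) : A) *: t =
    ract (fb (x - (eps x : A) *: p) + (eps x : A) *: t : bimod_homK X Y) a.
  have fbRx : ract (fb (x - (eps x : A) *: p) : bimod_homK X Y) a =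
      fb (ract x a - (eps x : A) *: ract p a).
    by rewrite -[LHS]/(homK_ract _ a) -fbR // ractDl ractN ract_lact.
  rewrite [RHS]ractDl fbRx epsaR {fbRx}.
  have -> : ract x a - (eps x * a : A) *: p =
     (ract x a - (eps x : A) *: ract p a) - (eps x : A) *: c a.
    by rewrite /c scalerBr scalerA opprB addrA subrK.
  rewrite fbD; first last.
  - by rewrite -scaleN1r !epsaZ ceps !mulr0.
  - by rewrite epsB epsaZ !epsaR p1 mul1r subrr.
  rewrite -[- (_ *: c a)]scaleN1r !fbZ ?epsaZ ?ceps ?mulr0 // -addrA; congr (_ + _).
  apply: homKP => y /=; rewrite -dE tP -!scalerA scaleN1r scalerBr opprB.
  by rewrite subrK.
exists (Bihom gl gr) => x /=.
by rewrite cy_epsd !scale0r subr0 addr0 fbE.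
Qed.

(** Let E be the extension of Y by X given by d. Projectivity lifts the map from the dual of P2
    through A to End_K(Y) to a map h into Hom_K(Y, E). On coboundaries rho vanishes, so h lands in
    Hom_K(Y, X) there; [dual_exact] extends this restriction to a map v on the whole dual of P2. *)
Lemma cy2_ext0 X Y n m (e : basis X n) (e' : basis Y m) : ext0 X Y -> ext0 Y X.
Proof.
move=> XY d.
have [r0 [q [psi qP]]] := fg_projective_dual_basis (cy_fgproj0 D).1 (cy_fgproj0 D).2.
have [r1 [p [phi pP]]] := fg_projective_dual_basis (cy_fgproj1 D).1 (cy_fgproj1 D).2.
have [r2 [s [chi sP]]] := fg_projective_dual_basis (cy_fgproj2 D).1 (cy_fgproj2 D).2.
pose E : lmodType A := twist d.
have [|h hP] := @dual_lift K A (cy_P2 D) r2 s chi _ _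
    (homK_post Y (@twist_out _ _ _ _ d)) (bihom_comp (homK_act Y) (cy_rho D)) sP.
  move=> w; pose t := homK_scale Y (cy_rho D w).
  have t'P (k : K) x y : (0, t (k%:A *: x + y)) =
      k%:A *: ((0, t x) : E) + ((0, t y) : E) :> E.
    by congr pair; [rewrite /= der_alg scaler0 !addr0 | exact: (homK_linear t)].
  by exists (HomK t'P); apply: homKP.
have h2 w y : ((h w : homK Y E) y).2 = (cy_rho D w : A) *: y.
  exact: (congr1 (fun t : homK Y Y => t y) (hP w)).
have h1P w (k : K) x y : ((h w : homK Y E) (k%:A *: x + y)).1 =
    k%:A *: ((h w : homK Y E) x).1 + ((h w : homK Y E) y).1.
  by rewrite homK_linear /= der_alg addr0.
pose h1 w : bimod_homK Y X := HomK (h1P w).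
have ul : linear (fun w => h1 (dual_map d2 w)).
  move=> a w w'; rewrite (bihom_linear (dual_map d2)); apply: homKP => y.
  rewrite [LHS]/= (bihom_linear h) /= -/(dual_map d2 w).
  by rewrite h2 cy_rhod scale0r der0 addr0.
have ur (w : bimod_dual (cy_P1 D)) a : h1 (dual_map d2 (ract w a)) = ract (h1 (dual_map d2 w)) a.
  rewrite (bihom_ract (dual_map d2)); apply: homKP => y.
  by rewrite [LHS]/= (bihom_ract h).
have [|v vP] := dual_exact e e' qP pP sP (ext0_bimod_exact XY) (u := Bihom ul ur).
  move=> w; have dd : dual_map d2 (dual_map d1 w) = 0.
    by apply: bihomP => x /=; rewrite cy_dd bihom0.
  by rewrite [LHS]/(h1 (dual_map d2 (dual_map d1 w))) dd; apply: homKP => y; rewrite /= bihom0.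
have [w w1 wc] := cy_fundamental D.
(* As h w lifts the identity of Y, the X-component of a (h w) - (h w) a is d a plus the commutator
   of a with h1 w. But a w - w a is a coboundary, where h1 and v agree. *)
exists (v w - h1 w) => a y.
have [w' w'E] := wc a.
have hE : (h (a *: w - ract w a) : homK Y E) y =
  a *: (h w : homK Y E) y - (h w : homK Y E) (a *: y).
  by rewrite (bihomB h) bihomZ bihom_ract.
have : h1 (a *: w - ract w a) = v (a *: w - ract w a) by rewrite w'E; apply: vP.
move=> /(congr1 (fun t : homK Y X => t y)).
rewrite [LHS]/= hE (bihomB v) bihomZ bihom_ract /= h2 w1 scale1r => hv.
rewrite /= scalerBr opprB [X in _ + X]addrC addrA [X in X + _]addrAC -hv.
by rewrite addrAC subrK addrAC subrr add0r.
Qed.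

End CalabiYau.

(** * The data in low degrees extracted from a 2-Calabi-Yau structure *)

Section Resolution.
Variables (K : fieldType) (A : algType K).

Lemma stalk_zero n (M : bimodule A) i (y : stalk n M i) : i != n -> y = 0.
Proof.
move: y; rewrite /=; case: (i == n) => // y _.
by apply/matrixP => j [].
Qed.

Lemma stalk_coboundary n (M : bimodule A) i (y : stalk n M i) :
  coboundary y <-> y = 0.
Proof. by split=> [[x <-] //|->]; exists 0. Qed.

Definition acyclic_at (X : complex A) i : Prop :=
  forall x : X i, cocycle x -> coboundary x.

Lemma coboundaryE (X : complex A) h i (x : X i) : h + 1 = i ->
  coboundary x -> exists y, cx_d X h i y = x.
Proof.
move=> hi; have hE : i - 1 = h by rewrite -hi addrK.
by subst h.
Qed.

Lemma coboundaryI (X : complex A) h i (y : X h) : h + 1 = i ->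
  coboundary (cx_d X h i y).
Proof.
move=> hi; have hE : i - 1 = h by rewrite -hi addrK.
by subst h; exists y.
Qed.

Lemma acyclic_atE (X : complex A) h i j : acyclic_at X i -> h + 1 = i -> i + 1 = j ->
  forall x, cx_d X i j x = 0 -> exists y, cx_d X h i y = x.
Proof.
by move=> Xi hi ij; subst j => x /Xi; apply: coboundaryE.
Qed.

Lemma quasi_iso_stalk_acyclic (X : complex A) n (M : bimodule A)
    (f : chain_map X (stalk n M)) i :
  quasi_iso f -> i != n -> acyclic_at X i.
Proof.
move=> fP ni x x0; apply: (fP i).1 => //.
by apply/stalk_coboundary; apply: stalk_zero.
Qed.

Lemma coboundaryD (X : complex A) i (x y : X i) :
  coboundary x -> coboundary y -> coboundary (x + y).
Proof. by move=> [x' <-] [y' <-]; exists (x' + y'); rewrite bihomD. Qed.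

Lemma coboundaryN (X : complex A) i (x : X i) : coboundary x -> coboundary (- x).
Proof. by move=> [x' <-]; exists (- x'); rewrite bihomN. Qed.

Lemma cocycleB (X : complex A) i (x y : X i) :
  cocycle x -> cocycle y -> cocycle (x - y).
Proof.
move=> x0 y0; change (cx_d X i (i + 1) (x - y) = 0).
by rewrite bihomB (x0 : cx_d X i (i + 1) x = 0) (y0 : cx_d X i (i + 1) y = 0) subrr.
Qed.

Lemma cocycleD (X : complex A) i (x y : X i) :
  cocycle x -> cocycle y -> cocycle (x + y).
Proof.
move=> x0 y0; change (cx_d X i (i + 1) (x + y) = 0).
by rewrite bihomD (x0 : cx_d X i (i + 1) x = 0) (y0 : cx_d X i (i + 1) y = 0) addr0.
Qed.

Lemma cocycleZ (X : complex A) i a (x : X i) : cocycle x -> cocycle (a *: x).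
Proof.
move=> x0; change (cx_d X i (i + 1) (a *: x) = 0).
by rewrite bihomZ (x0 : cx_d X i (i + 1) x = 0) scaler0.
Qed.

Lemma cocycleR (X : complex A) i a (x : X i) : cocycle x -> cocycle (ract x a).
Proof.
move=> x0; change (cx_d X i (i + 1) (ract x a) = 0).
by rewrite bihom_ract (x0 : cx_d X i (i + 1) x = 0) ract0.
Qed.

Lemma coboundaryZ (X : complex A) i a (x : X i) : coboundary x -> coboundary (a *: x).
Proof. by move=> [x' <-]; exists (a *: x'); rewrite bihomZ. Qed.

Lemma coboundaryR (X : complex A) i a (x : X i) : coboundary x -> coboundary (ract x a).
Proof. by move=> [x' <-]; exists (ract x' a); rewrite bihom_ract. Qed.

Lemma coboundary_map (X Y : complex A) (f : chain_map X Y) i (x : X i) :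
  coboundary x -> coboundary (f i x).
Proof. by move=> [y <-]; exists (f (i - 1) y); rewrite cm_comm. Qed.

Lemma quasi_iso_acyclic (X Y : complex A) (f : chain_map X Y) i :
  quasi_iso f -> acyclic_at X i -> acyclic_at Y i.
Proof.
move=> fP Xi y /((fP i).2) [x x0 yx]; rewrite -[y](subrK (f i x)).
exact/(coboundaryD yx)/coboundary_map/Xi.
Qed.

(** The isomorphism in the derived category gives a map to A only on cocycles of degree 2; a
    bimodule retraction extends it to the whole term. *)
Definition retracts (X : complex A) i : Prop :=
  exists r : bihom (X i) (X i), (forall x, cocycle (r x)) /\
    (forall x : X i, cocycle x -> r x = x).

Section DualComplex.
Variable P : complex A.
Hypothesis PP : forall i, bimod_fg (P i) /\ bimod_projective (P i).
Local Notation X := (dual_complex P).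

(** By acyclicity the values of r are coboundaries, so r lifts through the differential to some s,
    the dual term being projective; x - s (d x) is then a retraction one degree lower. *)
Lemma dual_retracts_step i :
  acyclic_at X (i + 1) -> retracts X (i + 1) -> retracts X i.
Proof.
move=> Xi [r [r0 rE]].
have [n [p [phi pP]]] := fg_projective_dual_basis (PP (- (i + 1))).1 (PP (- (i + 1))).2.
have [|s sP] := dual_lift (q := cx_d X i (i + 1)) (f := r) pP.
  by move=> u; apply: (acyclic_atE Xi) (r0 u).
have rl : linear (fun x : X i => x - s (cx_d X i (i + 1) x)).
  by move=> a x y; rewrite !bihom_linear opprD addrACA -scalerBr.
have rr (x : X i) a : ract x a - s (cx_d X i (i + 1) (ract x a)) =
    ract (x - s (cx_d X i (i + 1) x)) a.
  by rewrite !bihom_ract ractDl ractN.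
exists (Bihom rl rr); split=> [x|x x0].
  change (cx_d X i (i + 1) (x - s (cx_d X i (i + 1) x)) = 0).
  by rewrite bihomB sP rE ?subrr //; apply: cx_dd.
change (x - s (cx_d X i (i + 1) x) = x).
by have -> : cx_d X i (i + 1) x = 0 by []; rewrite bihom0 subr0.
Qed.

(** Descending induction from a degree where P vanishes, in which the zero map is a retraction. *)
Lemma dual_retracts i n : (forall j, i < j -> acyclic_at X j) ->
  (forall j, j = - (i + n%:Z) -> forall x : P j, x = 0) -> retracts X i.
Proof.
elim: n i => [|n IH] i Xi P0.
  exists (bihom_zero _ _); split=> [x|x _]; first exact: bihom0.
  by apply: bihomP => y; rewrite (P0 _ _ y) ?addr0 // !bihom0.
apply: dual_retracts_step; first by apply: Xi; rewrite ltrDl.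
apply: IH => [j ij|j ->].
  by apply: Xi; apply: lt_trans ij; rewrite ltrDl.
by apply: P0; rewrite -addrA -intS.
Qed.

End DualComplex.

Lemma calabi_yau2_data : calabi_yau A 2 -> inhabited (cy2_data A).
Proof.
move=> [P [e [[PP [n P0] eP] [Z [f [g [fP gP]]]]]]].
pose X := dual_complex P.
have Xacyc (i : int) : i != 2%:Z -> acyclic_at X i.
  by move=> i2; apply: (quasi_iso_acyclic fP); apply: quasi_iso_stalk_acyclic gP i2.
have [r [r0 rE]] : retracts X 2%:Z.
  apply: (@dual_retracts P PP _ n) => [j j2|_ ->].
    by apply: Xacyc; rewrite gt_eqF.
  by apply: P0; rewrite ltrN2 ltrDr orbT.
(* The map on cohomology through the roof: a cocycle x is cohomologous to some f z and goes to g z.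
   The value 0 on non-cocycles is a placeholder, as [rho] is only applied after [r]. *)
have /choice [rho rhoP] : forall x : X 2%:Z, exists a : A, cocycle x ->
    exists z, [/\ cocycle z, coboundary (x - f 2%:Z z) & g 2%:Z z = a].
  move=> x; have [/((fP _).2) [z z0 xz]|nx] := pselect (cocycle x); last by exists 0.
  by exists (g 2%:Z z) => _; exists z.
have rho_eq x z : cocycle x -> cocycle z -> coboundary (x - f 2%:Z z) ->
    rho x = g 2%:Z z.
  move=> x0 z0 xz; have [z' [z'0 xz' <-]] := rhoP x x0.
  have /stalk_coboundary : coboundary (g 2%:Z (z' - z)).
    apply/coboundary_map/(fP _).1; first exact: cocycleB.
    have -> : f 2%:Z (z' - z) = (x - f 2%:Z z) - (x - f 2%:Z z').
      by rewrite bihomB opprB [RHS]addrC addrA subrK.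
    by apply: coboundaryD => //; apply: coboundaryN.
  by rewrite bihomB => /eqP; rewrite subr_eq0 => /eqP.
have rl : linear (fun x => rho (r x) : bimod_reg A).
  move=> a x y; have [z [z0 xz <-]] := rhoP _ (r0 x).
  have [z' [z'0 yz' <-]] := rhoP _ (r0 y).
  rewrite -bihom_linear; apply: rho_eq => //.
    by apply: cocycleD => //; apply: cocycleZ.
  rewrite !bihom_linear opprD addrACA -scalerBr.
  by apply: coboundaryD => //; apply: coboundaryZ.
have rr x a : rho (r (ract x a)) = ract (rho (r x) : bimod_reg A) a.
  have [z [z0 xz <-]] := rhoP _ (r0 x).
  rewrite -(bihom_ract (g 2%:Z)); apply: rho_eq => //; first exact: cocycleR.
  by rewrite !bihom_ract -ractN -ractDl; apply: coboundaryR.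
have gg : exists2 z, cocycle z & g 2%:Z z = (1 : A).
  have [//|z z0 /stalk_coboundary] := (gP 2%:Z).2 (1 : A).
  by move=> /eqP; rewrite subr_eq0 => /eqP z1; exists z.
have [z z0 z1] := gg.
have e1 : exists x, e 0 x = (1 : A).
  have [//|x _ /stalk_coboundary] := (eP 0).2 (1 : A).
  by move=> /eqP; rewrite subr_eq0 => /eqP x1; exists x.
constructor.
refine (@CY2Data K A (P 0) (P (- 1%:Z)) (P (- 2%:Z))
  (cx_d P (- 1%:Z) 0) (cx_d P (- 2%:Z) (- 1%:Z)) (e 0)
  (Bihom rl rr) (PP _) (PP _) (PP _) _ _ _ _ e1 _ _).
- exact: cx_dd.
- by move=> x; rewrite cm_comm.
- apply: acyclic_atE => //; exact: (quasi_iso_stalk_acyclic eP).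
- move=> x x0; apply: coboundaryE => //; apply: (eP 0).1.
    by apply: (P0 (0 + 1)).
  exact/stalk_coboundary.
- move=> w; change (rho (r (cx_d X 1%:Z 2%:Z w)) = 0).
  rewrite rE; last exact: cx_dd.
  rewrite (rho_eq _ 0) ?bihom0 ?subr0 //; first exact: cx_dd.
    exact: bihom0.
  exact: coboundaryI.
- exists (f 2%:Z z).
  + have fz0 : cocycle (f 2%:Z z).
      change (cx_d X 2%:Z (2%:Z + 1) (f 2%:Z z) = 0).
      by rewrite -cm_comm (z0 : cx_d Z 2%:Z (2%:Z + 1) z = 0) bihom0.
    change (rho (r (f 2%:Z z : X 2%:Z)) = (1 : A)).
    rewrite rE // -[RHS]z1; apply: rho_eq => //.
    by rewrite subrr; exists 0; rewrite bihom0.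
  (* The commutator of a with z goes to a 1 - 1 a = 0 under g, hence is a coboundary in Z. *)
  + move=> a; suff /(@coboundaryE X 1%:Z) [//|v vE] :
        coboundary (a *: f 2%:Z z - ract (f 2%:Z z) a) by exists v; apply: esym.
    rewrite -bihomZ -bihom_ract -bihomB; apply/coboundary_map/(gP _).1.
      by apply: cocycleB; [exact: cocycleZ | exact: cocycleR].
    apply/stalk_coboundary; rewrite bihomB bihomZ (bihom_ract (g 2%:Z)) z1.
    by rewrite /= mul1r [_ *: _]mulr1 subrr.
Qed.

End Resolution.

(** * Isotypic modules and filtrations *)

Section SimpleModules.
Variables (K : fieldType) (A : algType K).
Implicit Types (M S X Y : lmodType A).

Lemma simple_submod S (V : set S) : simple_module S -> submod V ->
  (forall s, V s -> s = 0) \/ (forall s, V s).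
Proof.
move=> [_ S_simple] [V0 VP].
have [|U0|UT] := S_simple (fun s => `[< V s >]).
- split; first exact/asboolP.
  by move=> a u v /asboolP Vu /asboolP Vv; apply/asboolP/VP.
- by left=> s Vs; apply/eqP; have := U0 s; rewrite !inE => <-; apply/asboolP.
- by right=> s; have := UT s; rewrite !inE => /asboolP.
Qed.

Lemma simple_gen S (e s : S) : simple_module S -> e <> 0 -> exists a : A, a *: e = s.
Proof.
move=> S_simple e0; have [||VT] := @simple_submod S (fun s => exists a : A, a *: e = s) S_simple.
- split=> [|a x y [b <-] [c <-]]; first by exists 0; rewrite scale0r.
  by exists (a * b + c); rewrite scalerDl scalerA.
- by move=> V0; case: e0; apply: V0; exists 1; rewrite scale1r.
- exact: VT.
Qed.

Lemma Ann0 X : Ann X 0. Proof. by move=> x; rewrite scale0r. Qed.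
Lemma AnnD X a b : Ann X a -> Ann X b -> Ann X (a + b).
Proof. by move=> Xa Xb x; rewrite scalerDl Xa Xb addr0. Qed.
Lemma AnnMl X a b : Ann X b -> Ann X (a * b).
Proof. by move=> Xb x; rewrite -scalerA Xb scaler0. Qed.
Lemma AnnMr X a b : Ann X a -> Ann X (a * b).
Proof. by move=> Xa x; rewrite -scalerA Xa. Qed.

(* A decomposition A / Ann S = (+)_i A w_i, with A w_i identified with S by   *)
(* a w_i |-> a e_i.                                                           *)
Record frame S r (e : 'I_r -> S) (w : 'I_r -> A) : Prop := Frame {
  frame_neq0 : forall i, e i <> 0;
  frame_diag : forall i, w i *: e i = e i;
  frame_off : forall i j, i != j -> w i *: e j = 0;
  frame_sum : Ann S (1 - \sum_i w i);
  frame_ann : forall i a, a *: e i = 0 -> Ann S (a * w i)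
}.

(** Take a family of minimal size with joint annihilator Ann S. As [e i] cannot be dropped, some
    element kills the other members but not [e i], and simplicity turns it into a [w i] fixing
    [e i]. *)
Lemma simple_frame S : fin_dim S -> simple_module S -> exists r e w, @frame S r e w.
Proof.
move=> S_fin S_simple.
have ex_r : exists r, `[< exists e : 'I_r -> S, forall a,
    (forall i, a *: e i = 0) -> Ann S a >].
  have [n [b bP]] := S_fin; exists n; apply/asboolP; exists b => a ab s.
  have [c ->] := bP s; rewrite scaler_sumr big1 // => i _.
  by rewrite -algZC ab scaler0.
case: (ex_minnP ex_r) => r /asboolP [e eP] r_min; exists r, e.
have wP (i : 'I_r) : exists w : A, [/\ e i <> 0, w *: e i = e i &
    forall j, i != j -> w *: e j = 0].
  apply: contrapT => no_w; move: e eP r_min i no_w.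
  case: r => [|r] e eP r_min i no_w; first by case: i {no_w}.
  suff /r_min : `[< exists e : 'I_r -> S, forall a,
    (forall i, a *: e i = 0) -> Ann S a >] by rewrite ltnn.
  apply/asboolP; exists (fun j => e (lift i j)) => a ae.
  apply: eP => j'; case: (unliftP i j') => [k ->|->] //.
  apply: contrapT => aei; apply: no_w.
  have [b bae] := simple_gen (e i) S_simple aei.
  exists (b * a); split=> [ei0||j ij]; first by rewrite ei0 scaler0 in aei.
    by rewrite -scalerA.
  by move: ij; case: (unliftP i j) => [k ->|->]; rewrite ?eqxx // -scalerA ae scaler0.
have /choice [w {}wP] := wP; exists w; split.
- by move=> i; have [] := wP i.
- by move=> i; have [] := wP i.
- by move=> i j ij; have [_ _ ->] := wP i.
- apply: eP => j; rewrite scalerBl scale1r scaler_suml (bigD1 j) //=.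
  have [_ -> _] := wP j; rewrite big1 ?addr0 ?subrr // => i ij.
  by have [_ _ ->] := wP i.
- move=> i a ai; apply: eP => j; rewrite -scalerA.
  have [_ wii wij] := wP i; have [<-|ij] := eqVneq i j; first by rewrite wii.
  by rewrite wij ?scaler0.
Qed.

Section Frame.
Variables (S : lmodType A) (r : nat) (e : 'I_r -> S) (w : 'I_r -> A).
Hypotheses (S_simple : simple_module S) (ewP : frame e w).

Lemma frame_gen i a : a *: e i <> 0 -> exists b, Ann S (w i - b * a * w i).
Proof.
move=> ai; have [b bai] := simple_gen (e i) S_simple ai; exists b.
rewrite -{1}[w i]mul1r -mulrBl; apply: (frame_ann ewP).
by rewrite scalerBl scale1r -scalerA bai subrr.
Qed.

(* A submodule C maximal among those avoiding x has quotient S: for x not in  *)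
(* C some w_i x is not in C, and every w_j y lies in A x + C.                 *)
Lemma isotypic_separation M (L C0 : set M) (x : M) :
  submod L -> submod C0 -> (forall y, C0 y -> L y) ->
  (forall a y, Ann S a -> L y -> C0 (a *: y)) -> L x -> ~ C0 x ->
  exists g : M -> S, [/\ linear_on L g, forall y, C0 y -> g y = 0 & g x <> 0].
Proof.
move=> LP C0P C0L SL Lx C0x.
pose good (C : set M) := [/\ submod C, forall y, C0 y -> C y,
  forall y, C y -> L y & ~ C x].
pose T := {C : set M | good C}.
pose R (C D : T) := `[< forall y, sval C y -> sval D y >].
have t0 : T by exists C0.
have [||F F_tot|C C_max] := @ZL_preorder T t0 R.
- by move=> C; apply/asboolP.
- by move=> C D E /asboolP DC /asboolP CE; apply/asboolP => y /DC /CE.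
- have [[C1 FC1]|F0] := pselect (exists C, F C); last first.
    by exists t0 => C FC; case: F0; exists C.
  pose U : set M := fun y => exists2 C, F C & sval C y.
  have U_good : good U.
    split=> [|y C0y|y [C _ Cy]|[C _ Cx]].
    - split=> [|a y z [C FC Cy] [D FD Dz]].
        by exists C1 => //; case: (svalP C1) => - [].
      have [/asboolP CD|/asboolP DC] := F_tot _ _ FC FD.
        by exists D => //; case: (svalP D) => - [_ +] _ _ _; apply=> //; apply: CD.
      by exists C => //; case: (svalP C) => - [_ +] _ _ _; apply=> //; apply: DC.
    - by exists C1 => //; case: (svalP C1) => _ + _ _; apply.
    - by case: (svalP C) => _ _ + _; apply.
    - by case: (svalP C) => _ _ _; apply.
  by exists (exist _ U U_good) => C FC; apply/asboolP => y Cy; exists C.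
case: C C_max => C CG C_max; have [CP C0C CL Cx] := CG.
have xP y : L y -> ~ C y -> exists a, C (x - a *: y).
  move=> Ly Cy; apply: contrapT => no_a.
  pose D : set M := fun z => exists a c, C c /\ z = a *: y + c.
  have D_good : good D.
    split.
    - split=> [|a _ _ [b [c [Cc ->]]] [b' [c' [Cc' ->]]]].
        by exists 0, 0; rewrite scale0r addr0; split=> //; apply: submod0 CP.
      exists (a * b + b'), (a *: c + c'); split.
        by apply: submodD => //; apply: submodZ.
      by rewrite scalerDr scalerDl scalerA addrACA.
    - by move=> z /C0C Cz; exists 0, z; rewrite scale0r add0r.
    - move=> _ [a [c [Cc ->]]]; apply: submodD => //; last exact: CL.
      exact: submodZ.
    - by move=> [a [c [Cc xE]]]; apply: no_a; exists a; rewrite xE addrAC subrr add0r.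
  have /asboolP DC : R (exist _ D D_good) (exist _ C CG).
    by apply: C_max; apply/asboolP => z Cz; exists 0, z; rewrite scale0r add0r.
  by apply/Cy/DC; exists 1, 0; rewrite scale1r addr0; split=> //; apply: submod0 CP.
have decomp y : L y -> exists c, C0 c /\ y = c + \sum_i w i *: y.
  move=> Ly; exists ((1 - \sum_i w i) *: y).
  by rewrite -scaler_suml -scalerDl subrK scale1r; split=> //; apply/SL/Ly/(frame_sum ewP).
have [i Cwx] : exists i, ~ C (w i *: x).
  apply: contrapT => Cw; apply: Cx; have [c [C0c ->]] := decomp x Lx.
  apply: submodD => //; first exact: C0C.
  by apply: submod_sum => // i; apply: contrapT => Cwi; apply: Cw; exists i.
pose x0 := w i *: x; have Lx0 : L x0 by apply: submodZ.
have [c xc] := xP x0 Lx0 Cwx.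
(* Thus A x0 + C modulo C is a copy of A e_i = S. *)
have Cx0 a : C (a *: x0) <-> a *: e i = 0.
  split=> [Cax|ai]; last first.
    by rewrite scalerA; apply/C0C/SL => //; apply: (frame_ann ewP).
  apply: contrapT => /frame_gen [b bP]; apply: Cwx.
  apply: (submodBK CP _ (submodZ CP b Cax)).
  rewrite /x0 !scalerA -scalerBl ?mulrA; apply: C0C; exact: SL.
(* If w_j y is not in C, maximality gives x = a w_j y modulo C; with b a w_j = w_j modulo Ann S this
   yields w_j y = b x = b c x0 modulo C. *)
have wy j y : L y -> exists a, C (w j *: y - a *: x0).
  move=> Ly; have Lwy : L (w j *: y) by apply: submodZ.
  have [Cw|Cw] := pselect (C (w j *: y)).
    by exists 0; rewrite scale0r subr0.
  have [a xa] := xP _ Lwy Cw.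
  have /frame_gen [b bP] : a *: e j <> 0.
    move=> /(frame_ann ewP) aj; apply: Cx.
    by apply: (submodBK CP xa); rewrite scalerA; apply/C0C/SL.
  exists (b * c).
  have -> : w j *: y - (b * c) *: x0 = (w j - b * a * w j) *: y -
      b *: (x - a *: (w j *: y)) + b *: (x - c *: x0).
    by rewrite !scalerBr scalerBl !scalerA ?mulrA opprB !addrA !subrK.
  apply: submodD => //; last exact: submodZ.
  by apply: submodB => //; [apply/C0C/SL | apply: submodZ].
have /choice [h hP] : forall y, exists a, L y -> C (y - a *: x0).
  move=> y; have [Ly|] := pselect (L y); last by exists 0.
  have [d [C0d yE]] := decomp y Ly.
  have /choice [a aP] := fun j => wy j y Ly.
  exists (\sum_j a j) => _; rewrite {1}yE scaler_suml -addrA -sumrB.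
  by apply: submodD => //; [exact: C0C | exact: submod_sum].
exists (fun y => h y *: e i); split.
- move=> a y z Ly Lz; apply/eqP; rewrite scalerA -scalerDl -subr_eq0 -scalerBl.
  apply/eqP/Cx0; rewrite scalerBl scalerDl -scalerA.
  have Lyz : L (a *: y + z) by case: LP => _; apply.
  have -> : h (a *: y + z) *: x0 - (a *: (h y *: x0) + h z *: x0) =
      a *: (y - h y *: x0) + (z - h z *: x0) - (a *: y + z - h (a *: y + z) *: x0).
    by rewrite scalerBr addrACA -opprD opprB [RHS]addrC addrA subrK.
  apply: submodB => //; last exact: hP.
  by case: CP => _; apply; apply: hP.
- move=> y C0y; apply/Cx0; rewrite -[_ *: _](subKr y).
  by apply: submodB => //; [exact: C0C | apply/hP/C0L].
- move=> /Cx0 Chx; apply: Cx; by apply: (submodBK CP _ Chx); apply: hP.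
Qed.

End Frame.
End SimpleModules.

(** * Finite filtrations with isotypic quotients *)

Section Filtrations.
Variables (K : fieldType) (A : algType K).
Implicit Types (M S X Y : lmodType A).

Definition adjoin M (L : set M) (y : M) : set M :=
  fun m => exists l (a : A), L l /\ m = l + a *: y.

Fixpoint generated M (L : set M) (ys : seq M) : set M :=
  if ys is y :: ys' then generated (adjoin L y) ys' else L.

Lemma submod_adjoin M (L : set M) y : submod L -> submod (adjoin L y).
Proof.
move=> LP; split=> [|a _ _ [l [b [Ll ->]]] [l' [b' [Ll' ->]]]].
  by exists 0, 0; rewrite scale0r addr0; split=> //; apply: submod0 LP.
exists (a *: l + l'), (a * b + b'); split; first by case: LP => _; apply.
by rewrite scalerDr scalerDl scalerA addrACA.
Qed.

Lemma adjoin_sub M (L : set M) y m : L m -> adjoin L y m.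
Proof. by move=> Lm; exists m, 0; rewrite scale0r addr0. Qed.

Lemma adjoin_mem M (L : set M) y : submod L -> adjoin L y y.
Proof. by move=> LP; exists 0, 1; rewrite scale1r add0r; split=> //; apply: submod0 LP. Qed.

Lemma submod_generated M (L : set M) ys : submod L -> submod (generated L ys).
Proof. by elim: ys L => //= y ys IH L /submod_adjoin/IH. Qed.

Lemma generated_sub M (L : set M) ys m : L m -> generated L ys m.
Proof. by elim: ys L => //= y ys IH L Lm; apply/IH/adjoin_sub. Qed.

Lemma generated_mem M (L : set M) ys y : submod L -> y \in ys -> generated L ys y.
Proof.
elim: ys L => //= z ys IH L LP; rewrite inE => /predU1P[->|yys].
  exact/generated_sub/adjoin_mem.
by apply: IH => //; apply: submod_adjoin.
Qed.

Lemma generated_min M (L V : set M) ys : submod V -> (forall m, L m -> V m) ->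
  (forall y, y \in ys -> V y) -> forall m, generated L ys m -> V m.
Proof.
move=> VP; elim: ys L => //= y ys IH L LV ysV; apply: IH => [_ [l [a [Ll ->]]]|z zys].
  apply: submodD => //; first exact: LV.
  by apply: submodZ => //; apply: ysV; rewrite mem_head.
by apply: ysV; rewrite inE zys orbT.
Qed.

Definition fin_gen M (V : set M) : Prop :=
  exists ys : seq M, (forall y, y \in ys -> V y) /\
    forall L, submod L -> (forall y, y \in ys -> L y) -> forall v, V v -> L v.

(* [filt X L L']: a finite chain of submodules from L to L' with all          *)
(* successive quotients isomorphic to X.                                      *)
Inductive filt X M (L : set M) : set M -> Prop :=
| filt_refl : filt X L L
| filt_step L1 L2 (q : M -> X) :
    filt X L L1 -> submod L2 -> linear_on L2 q ->
    (forall x, exists2 v, L2 v & q v = x) ->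
    (forall v, L1 v <-> L2 v /\ q v = 0) -> filt X L L2.

Lemma filt_trans X M (L L1 L2 : set M) : filt X L L1 -> filt X L1 L2 -> filt X L L2.
Proof. by move=> LL1; elim=> // L3 L4 q _; apply: filt_step. Qed.

Lemma filt_extend X Y M n (e : basis X n) (L L' : set M) (g : M -> Y) :
  ext0 X Y -> filt X L L' -> linear_on L g ->
  exists G : M -> Y, linear_on L' G /\ forall v, L v -> L' v /\ G v = g v.
Proof.
move=> XY LL' gP; elim: LL' => [|L1 L2 q _ [G1 [G1P G1E]] L2P qP q_surj L1E].
  by exists g.
have [|G [GP GE]] := ext0_extend (g := G1) e XY L2P qP q_surj.
  by move=> a x y /L1E L1x /L1E L1y; apply: G1P.
exists G; split=> // v /G1E [/L1E [L2v qv] <-]; split=> //; exact: GE.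
Qed.

(** The hypothesis says that eps |-> t defines a map E -> M / L', which is lifted to M / L one layer
    at a time. For a layer with quotient map q, the homomorphism a |-> q (a t) on the annihilator of
    eps extends to A because Ext^1(E, X) = 0; subtracting from t a preimage of its value at 1 gives
    the correction. *)
Lemma filt_lift X E M n (b : basis E n) (eps : E) (L L' : set M) (t : M) :
  ext0 E X -> (forall x, exists a : A, a *: eps = x) -> filt X L L' ->
  (forall a : A, a *: eps = 0 -> L' (a *: t)) ->
  exists t', L' (t - t') /\ forall a : A, a *: eps = 0 -> L (a *: t').
Proof.
move=> EX E_gen LL'; elim: LL' t => [|L1 L2 q _ IH L2P qP q_surj L1E] t tP.
  exists t; split=> //.
  by rewrite subrr -(scale0r t); apply: tP; rewrite scale0r.
have [||||G [GP GE]] := ext0_extend (V := setT) (M := A^o) (q := fun a => (a : A) *: eps)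
    (g := fun a => q ((a : A) *: t)) b EX.
- by [].
- by move=> a x y _ _; rewrite scalerDl -scalerA.
- by move=> x; have [a <-] := E_gen x; exists a.
- move=> a x y [_ x0] [_ y0]; rewrite scalerDl -scalerA qP //; exact: tP.
have GZ (a : A) : G a = a *: G (1 : A).
  by rewrite -(linear_onZ _ GP) //; congr G; rewrite [RHS]mulr1.
have [l L2l ql] := q_surj (G (1 : A)).
have [|t' [L1t' t'P]] := IH (t - l).
  move=> a a0; apply/L1E; rewrite scalerBr; split.
    by apply: submodB => //; [exact: tP | exact: submodZ].
  rewrite (linear_onB L2P qP (tP _ a0) (submodZ L2P a L2l)) (linear_onZ L2P qP a L2l).
  by rewrite -[q (a *: t)]GE // GZ ql subrr.
exists t'; split=> //; rewrite -[t](subrK l) addrAC; apply: submodD => //.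
by have /L1E [] := L1t'.
Qed.

Section Frame.
Variables (S : lmodType A) (r : nat) (e : 'I_r -> S) (w : 'I_r -> A).
Hypotheses (S_simple : simple_module S) (ewP : frame e w).
Variable M : lmodType A.
Implicit Types (L : set M) (y : M).

(** Unless w_i y already lies in L, a w_i y is in L exactly when a e_i = 0, so the new layer is A
    e_i = S. *)
Lemma filt_adjoin_frame L y i : submod L -> (forall a, Ann S a -> L (a *: y)) ->
  filt S L (adjoin L (w i *: y)).
Proof.
move=> LP Sy; have [Lwy|Lwy] := pselect (L (w i *: y)).
  have -> : adjoin L (w i *: y) = L; last exact: filt_refl.
  apply/funext => m; apply/propext; split=> [[l [a [Ll ->]]]|]; last exact: adjoin_sub.
  by apply: submodD => //; apply: submodZ.
have L0 (a : A) : L (a *: (w i *: y)) <-> a *: e i = 0.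
  split=> [La|ai]; last by rewrite scalerA; apply/Sy/(frame_ann ewP).
  apply: contrapT => /(frame_gen S_simple ewP) [b bP]; apply: Lwy.
  apply: (submodBK LP _ (submodZ LP b La)).
  by rewrite !scalerA -scalerBl ?mulrA; apply: Sy.
have /choice [h hP] : forall m, exists a : A,
    adjoin L (w i *: y) m -> L (m - a *: (w i *: y)).
  move=> m; have [[l [a [Ll ->]]]|] := pselect (adjoin L (w i *: y) m).
    by exists a => _; rewrite addrK.
  by exists 0.
have hE m (a : A) : L (m - a *: (w i *: y)) -> h m *: e i = a *: e i.
  move=> Lma; apply/eqP; rewrite -subr_eq0 -scalerBl; apply/eqP/L0.
  have : adjoin L (w i *: y) m by exists (m - a *: (w i *: y)), a; rewrite subrK.
  move=> /hP Lmh; rewrite scalerBl.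
  have -> : h m *: (w i *: y) - a *: (w i *: y) =
    (m - a *: (w i *: y)) - (m - h m *: (w i *: y)) by rewrite opprB [RHS]addrC addrA subrK.
  exact: submodB.
apply: (filt_step (q := fun m => h m *: e i)) (filt_refl _ _) (submod_adjoin _ LP) _ _ _.
- move=> a x z Lx Lz; rewrite scalerA -scalerDl; apply: hE.
  rewrite scalerDl -scalerA opprD addrACA -scalerBr.
  by case: LP => _; apply; apply: hP.
- move=> s; have [a <-] := simple_gen s S_simple (frame_neq0 ewP (i := i)).
  exists (a *: (w i *: y)); last by apply: hE; rewrite subrr; apply: submod0 LP.
  by apply: (submodZ (submod_adjoin _ LP)); apply: adjoin_mem.
- move=> m; split=> [Lm|[Lm /L0 hm]].
    split; first exact: adjoin_sub.
    by rewrite (hE m 0) ?scale0r // subr0.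
  by apply: (submodBK LP _ hm); apply: hP.
Qed.

Lemma filt_generated_frame L y s : submod L -> (forall a, Ann S a -> L (a *: y)) ->
  filt S L (generated L [seq w i *: y | i <- s]).
Proof.
elim: s L => [|i s IH] L LP Ly /=; first exact: filt_refl.
apply: filt_trans (filt_adjoin_frame i LP Ly) _.
by apply: IH => [|a Sa]; [exact: submod_adjoin | apply/adjoin_sub/Ly].
Qed.

Lemma filt_adjoin L y : submod L -> (forall a, Ann S a -> L (a *: y)) ->
  filt S L (adjoin L y).
Proof.
move=> LP Ly; have := filt_generated_frame (enum 'I_r) LP Ly.
congr filt; apply/funext => m; apply/propext; split.
  apply: generated_min; [exact: submod_adjoin | exact: adjoin_sub|].
  by move=> _ /mapP[i _ ->]; apply: submodZ; [exact: submod_adjoin | exact: adjoin_mem].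
have gP := submod_generated [seq w i *: y | i <- enum 'I_r] LP.
move=> [l [a [Ll ->]]]; apply: submodD => //; first exact: generated_sub.
apply: submodZ => //; have yE : y = (1 - \sum_i w i) *: y + (\sum_i w i) *: y.
  by rewrite -scalerDl subrK scale1r.
rewrite [X in generated _ _ X]yE.
apply: submodD => //; first by apply: generated_sub; apply: Ly; apply: (frame_sum ewP).
rewrite scaler_suml; apply: submod_sum => // i; apply: generated_mem => //.
by apply/mapP; exists i => //; rewrite mem_enum.
Qed.

(** Generators y are adjoined one at a time, each through the finitely many elements w_i y. *)
Lemma filt_isotypic (L0 L : set M) : submod L0 -> submod L ->
  (forall m, L0 m -> L m) -> (forall a y, Ann S a -> L y -> L0 (a *: y)) ->
  fin_gen L -> filt S L0 L.
Proof.
move=> L0P LP L0L SL [ys [ysL ys_gen]].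
have : filt S L0 (generated L0 ys).
  have : forall y, y \in ys -> forall a, Ann S a -> L0 (a *: y).
    by move=> y /ysL Ly a Sa; apply: SL.
  elim: (ys) (L0) L0P => [|y zs IH] L1 L1P zsP /=; first exact: filt_refl.
  apply: filt_trans (filt_adjoin L1P (zsP y (mem_head _ _))) _.
  apply: IH => [|z zzs a Sa]; first exact: submod_adjoin.
  by apply/adjoin_sub/zsP => //; rewrite inE zzs orbT.
congr filt; apply/funext => m; apply/propext; split; first exact: generated_min.
apply: ys_gen; first exact: submod_generated.
by move=> y yys; apply: generated_mem.
Qed.

End Frame.

Lemma fin_gen_setT : fin_gen (setT : set A^o).
Proof.
exists [:: (1 : A^o)]; split=> // L LP L1 v _.
by rewrite -[v]mulr1; apply: (submodZ LP (v : A)); apply: L1; rewrite mem_head.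
Qed.

End Filtrations.

(** * Products of annihilators *)

Section Ideals.
Variables (K : fieldType) (A : algType K).
Implicit Types (I J C : set A) (S T X Y : lmodType A).

Lemma ideal_mul_min I J C : C 0 -> (forall a b, C a -> C b -> C (a + b)) ->
  (forall a b, I a -> J b -> C (a * b)) -> forall a, ideal_mul I J a -> C a.
Proof.
move=> C0 CD CM _ [n [x [y [Ix Jy ->]]]].
by elim/big_ind: _ => // i _; apply: CM.
Qed.

Lemma ideal_mul_mem I J a b : I a -> J b -> ideal_mul I J (a * b).
Proof. by move=> Ia Jb; exists 1, (fun=> a), (fun=> b); rewrite big_ord1. Qed.

Lemma ideal_mul0 I J : ideal_mul I J 0.
Proof.
exists 0, (fun=> 0), (fun=> 0); rewrite big_ord0.
by split=> // -[].
Qed.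

Lemma ideal_mulD I J a b : ideal_mul I J a -> ideal_mul I J b -> ideal_mul I J (a + b).
Proof.
move=> [n [x [y [Ix Jy ->]]]] [m [z [t [Iz Jt ->]]]].
pose u i := match split i with inl j => x j | inr j => z j end.
pose v i := match split i with inl j => y j | inr j => t j end.
exists (n + m)%N, u, v; split.
- by move=> i; rewrite /u; case: (split i).
- by move=> i; rewrite /v; case: (split i).
rewrite big_split_ord /u /v; congr (_ + _); apply: eq_bigr => i _.
  by rewrite (unsplitK (inl i)).
by rewrite (unsplitK (inr i)).
Qed.

Lemma ideal_mul_lmul I J a b : (forall c d, I d -> I (c * d)) ->
  ideal_mul I J b -> ideal_mul I J (a * b).
Proof.
move=> I_l [n [x [y [Ix Jy ->]]]]; rewrite mulr_sumr.
exists n, (fun i => a * x i), y; split=> // [i|]; first exact: I_l.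
by apply: eq_bigr => i _; rewrite mulrA.
Qed.

Lemma ideal_mul_rmul I J a b : (forall c d, J d -> J (d * c)) ->
  ideal_mul I J b -> ideal_mul I J (b * a).
Proof.
move=> J_r [n [x [y [Ix Jy ->]]]]; rewrite mulr_suml.
exists n, x, (fun i => y i * a); split=> // [i|]; first exact: J_r.
by apply: eq_bigr => i _; rewrite mulrA.
Qed.

Lemma submod_ideal_mul I J : (forall c d, I d -> I (c * d)) ->
  submod (ideal_mul I J : set A^o).
Proof.
move=> I_l; split=> [|a x y Ix Iy]; first exact: ideal_mul0.
by apply: ideal_mulD => //; apply: ideal_mul_lmul.
Qed.

Lemma submod_Ann X : submod (Ann X : set A^o).
Proof.
split=> [|a x y Xx Xy]; first exact: Ann0.
by apply: AnnD => //; apply: AnnMl.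
Qed.

Lemma ideal_mulA I J L a :
  ideal_mul (ideal_mul I J) L a <-> ideal_mul I (ideal_mul J L) a.
Proof.
split; apply: ideal_mul_min; try exact: ideal_mul0; try exact: ideal_mulD.
  move=> x b IJx Lb; move: x IJx; apply: ideal_mul_min.
  - by rewrite mul0r; apply: ideal_mul0.
  - by move=> x y; rewrite mulrDl; apply: ideal_mulD.
  - by move=> x y Ix Jy; rewrite -mulrA; apply/ideal_mul_mem/ideal_mul_mem.
move=> a' x Ia'; move: x; apply: ideal_mul_min.
- by rewrite mulr0; apply: ideal_mul0.
- by move=> x y; rewrite mulrDr; apply: ideal_mulD.
- move=> x y Jx Ly; rewrite mulrA; apply: ideal_mul_mem => //; exact: ideal_mul_mem.
Qed.

Lemma ideal_mul_Ann_subl X J a : ideal_mul (Ann X) J a -> Ann X a.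
Proof.
apply: ideal_mul_min; [exact: Ann0 | exact: AnnD|].
by move=> x y Xx _; apply: AnnMr.
Qed.

Lemma ideal_mul_Ann_subr X I a : ideal_mul I (Ann X) a -> Ann X a.
Proof.
apply: ideal_mul_min; [exact: Ann0 | exact: AnnD|].
by move=> x y _; apply: AnnMl.
Qed.

Definition act_on (S : lmodType A) (e : S) (a : A^o) : S := (a : A) *: e.
Lemma act_on_linear (S : lmodType A) (e : S) : linear (act_on e).
Proof. by move=> a b c; rewrite /act_on scalerDl -scalerA. Qed.
HB.instance Definition _ (S : lmodType A) (e : S) :=
  GRing.isLinear.Build A A^o S *:%R (act_on e) (act_on_linear e).

Section FiniteGeneration.
Variables (D : cy2_data A) (S : lmodType A).
Hypotheses (S_fin : fin_dim S) (S_simple : simple_module S).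

(* A lift tau of the action P0 -> End_K(S) to Hom_K(S, A) turns the           *)
(* finitely many relations of the bimodule A into generators of the           *)
(* annihilator of e.                                                          *)
Lemma fin_gen_ann_elt (e : S) : e <> 0 ->
  fin_gen [set a : A^o | (a : A) *: e = 0]%classic.
Proof.
move=> e0; have [n [b]] := fin_dim_basis S_fin.
have [p p1] := cy_eps_surj D.
have [m [g gP]] := (cy_fgproj1 D).1.
have [|tau tauP] := (cy_fgproj0 D).2 _ _ (homK_post S (act_on e))
    (bihom_comp (homK_act S) (cy_eps D)).
  move=> f; have [||||h hP] := homK_lift (V := setT) (q := act_on e) b f.
  - by [].
  - by [].
  - by move=> a x y _ _; rewrite act_on_linear.
  - by move=> s; have [a <-] := simple_gen s S_simple e0; exists a.
  by exists h; apply: homKP => s /=; have [] := hP s.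
have tauE x s : ((tau x : homK S A^o) s : A) *: e = (cy_eps D x : A) *: s.
  exact: (congr1 (fun f : homK S S => f s) (tauP x)).
pose G (i : 'I_m * 'I_n) : A^o := (tau (cy_d1 D (g i.1)) : homK S A^o) (b i.2).
pose c : A^o := (tau p : homK S A^o) e - (1 : A).
exists (c :: [seq G i | i <- enum [set: 'I_m * 'I_n]%SET]); split=> [y|L LP Lys v v0].
  rewrite inE => /predU1P[->|/mapP[i _ ->]] /=.
    by rewrite /c /= scalerBl tauE p1 subrr.
  by rewrite /G /= tauE cy_epsd scale0r.
have LG l k : L (G (l, k)).
  by apply: Lys; rewrite inE map_f ?orbT // mem_enum inE.
have Lc : L c by apply: Lys; rewrite mem_head.
have Ld y s : L ((tau (cy_d1 D y) : homK S A^o) s).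
  have [l [a1 [a2 [k ->]]]] := gP y.
  have sumE q (F : 'I_q -> homK S A^o) : (\sum_i F i) s = \sum_i F i s.
    by elim/big_rec2: _ => //= i u u' _ <-.
  rewrite !bihom_sum sumE; apply: submod_sum => // j.
  rewrite !bihom_ract !bihomZ /=; apply: submodZ => //.
  rewrite (coordE b (a2 j *: s)) homK_sum; apply: submod_sum => // q.
  by rewrite homKZ; apply: submodZ => //; apply: LG.
have v0' : (v : A) *: e = 0 by [].
(* Since v e = 0, v tau(p)(e) is the value at e of tau (v p - p v), and v p - p v comes from P1. *)
have [y yE] : exists y, cy_d1 D y = (v : A) *: p - ract p (v : A).
  apply: cy_exact0; rewrite bihomB bihomZ bihom_ract p1 /=.
  by rewrite mul1r [_ *: _]mulr1 subrr.
apply: (submodBK LP (y := (v : A) *: (tau p : homK S A^o) e)); last first.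
  have := Ld y e; rewrite yE bihomB bihomZ bihom_ract /=.
  by rewrite v0' homK0 subr0.
have -> : v - (v : A) *: ((tau p : homK S A^o) e) = - ((v : A) *: c).
  rewrite /c scalerBr opprB; congr (_ - _).
  exact: esym (mulr1 _).
by apply: submodN => //; apply: submodZ.
Qed.

(** Write v = v (1 - sum_i w_i) + sum_i v w_i. For v in Ann S each v e_i is 0, so generators x of
    the annihilator of e_i supply the generators x w_i. *)
Lemma fin_gen_Ann : fin_gen (Ann S : set A^o).
Proof.
have [r [e [w ewP]]] := simple_frame S_fin S_simple.
have /choice [xs xsP] i := fin_gen_ann_elt (frame_neq0 ewP (i := i)).
exists ((1 - \sum_i w i : A^o) :: [seq ((x : A) * w i : A^o) | i <- enum 'I_r, x <- xs i]).
split=> [y|L LP Lys v Sv].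
  rewrite inE => /predU1P[->|/allpairsPdep [i [x [_ xxs ->]]]].
    exact: (frame_sum ewP).
  by apply: (frame_ann ewP); apply: (xsP i).1.
have -> : v = (v : A) *: (1 - \sum_i w i : A^o) + \sum_i ((v : A) * w i : A^o).
  by rewrite -mulr_sumr [X in X + _]mulrBr [X in X - _ + _]mulr1 subrK.
apply: submodD => //.
  by apply: submodZ => //; apply: Lys; rewrite mem_head.
apply: submod_sum => // i.
apply: ((xsP i).2 (fun x => L ((x : A) * w i : A^o))) => [|x xxs|].
- split=> [|a x y Lx Ly]; first by rewrite mul0r; apply: submod0 LP.
  by rewrite mulrDl -mulrA; case: LP => _; apply.
- apply: Lys; rewrite inE; apply/orP; right; apply/allpairsPdep.
  by exists i, x; rewrite mem_enum.
- exact: Sv.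
Qed.

End FiniteGeneration.
End Ideals.

(** * Ext^1 of the middle term of an extension *)

Section Ext.
Variables (K : fieldType) (A : algType K).
Implicit Types (S T X Y Z : lmodType A).

Definition der_sub (X Y : lmodType A) (d : derivation X Y) (t : homK X Y) :
  derivation X Y.
refine (@Derivation K A X Y (fun a x => d a x - (a *: t x - t (a *: x))) _ _ _ _).
- move=> a b x; rewrite derDl addrACA -opprD; congr (_ - _).
  by rewrite !scalerDl homKD opprD addrACA.
- move=> a x y; rewrite derDr addrACA -opprD; congr (_ - _).
  by rewrite scalerDr !homKD scalerDr opprD addrACA.
- move=> a b x; rewrite derM scalerBr addrACA -opprD scalerBr !scalerA; congr (_ - _).
  by rewrite addrA subrK.
- by move=> k x; rewrite der_alg homKZ !subrr.
Defined.

Lemma der_sub_inner X Y (d : derivation X Y) (t t' : homK X Y) :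
  (forall a x, der_sub d t a x = a *: t' x - t' (a *: x)) ->
  exists u : homK X Y, forall a x, d a x = a *: u x - u (a *: x).
Proof.
move=> dE; exists (t' + t) => a x /=; rewrite scalerDr opprD addrACA -dE /=.
by rewrite subrK.
Qed.

Definition der_post (X Y Z : lmodType A) (f : {linear Y -> Z}) (d : derivation X Y) :
  derivation X Z.
refine (@Derivation K A X Z (fun a x => f (d a x)) _ _ _ _).
- by move=> a b x; rewrite derDl linearD.
- by move=> a x y; rewrite derDr linearD.
- by move=> a b x; rewrite derM linearP.
- by move=> k x; rewrite der_alg linear0.
Defined.

Definition der_pre (X Y Z : lmodType A) (f : {linear Z -> X}) (d : derivation X Y) :
  derivation Z Y.
refine (@Derivation K A Z Y (fun a x => d a (f x)) _ _ _ _).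
- by move=> a b x; rewrite derDl.
- by move=> a x y; rewrite linearD derDr.
- by move=> a b x; rewrite derM linearZ_LR.
- by move=> k x; rewrite der_alg.
Defined.

Lemma ext0_iso X Y Z (h : {linear Y -> Z}) : injective h -> (forall z, exists y, h y = z) ->
  ext0 X Z -> ext0 X Y.
Proof.
move=> h_inj h_surj XZ d; have [t tP] := XZ (der_post h d).
have /choice [u uP] x := h_surj (t x).
have ul (k : K) x y : u (k%:A *: x + y) = k%:A *: u x + u y.
  by apply: h_inj; rewrite linearP !uP homK_linear.
by exists (HomK ul) => a x /=; apply: h_inj; rewrite linearB linearZ_LR !uP -tP.
Qed.

Section Extension.
Variables (S T : lmodType A) (n : nat) (b : basis S n) (xi : extension S T).

Lemma ext_in0 t : ext_out xi (ext_in xi t) = 0.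
Proof. by apply/ext_exact; exists t. Qed.

Lemma ext_section : exists s : homK S xi, forall x, ext_out xi (s x) = x.
Proof.
have [||||s sP] := homK_lift (V := setT) (q := ext_out xi) b (homK_of_linear idfun).
- by [].
- by [].
- by move=> a x y _ _; rewrite linearP.
- by move=> x; have [y] := ext_out_surj xi x; exists y.
by exists s => x; have [_ ->] := sP x.
Qed.

Lemma ext_fin_dim : fin_dim T -> fin_dim xi.
Proof.
move=> [m [f fP]]; have [s sP] := ext_section.
exists (n + m)%N, (fun i => match split i with inl i => s (b i) | inr j => ext_in xi (f j) end).
move=> x; have /ext_exact [t tE] : ext_out xi (x - s (ext_out xi x)) = 0.
  by rewrite linearB sP subrr.
have [c cE] := fP t.
exists (fun i => match split i with inl i => coord b (ext_out xi x) i | inr j => c j end).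
rewrite big_split_ord /=.
rewrite -[LHS](subrK (s (ext_out xi x))) -tE [LHS]addrC; congr (_ + _).
  rewrite [in LHS](coordE b (ext_out xi x)) homK_sum; apply: eq_bigr => i _.
  by rewrite (unsplitK (inl i)) homKZ.
rewrite cE linear_sum; apply: eq_bigr => i _.
by rewrite (unsplitK (inr i)) linearZ_LR.
Qed.

(** Exactness of Hom(T, T) -> Ext^1(S, T) -> Ext^1(xi, T) -> Ext^1(T, T) = 0: the hypothesis makes
    the connecting map phi |-> phi xi surjective. *)
Lemma ext0_middle_left :
  (forall eta : extension S T, exists phi : {linear T -> T}, ext_lact phi xi eta) ->
  ext0 T T -> ext0 xi T.
Proof.
move=> xi_gen TT d.
have [psi psiP] := TT (der_pre (ext_in xi) d).
have [s sP] := ext_section.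
have /choice [rho rhoP] x : exists t, ext_in xi t = x - s (ext_out xi x).
  by apply/ext_exact; rewrite linearB sP subrr.
have rho_l (k : K) x y : rho (k%:A *: x + y) = k%:A *: rho x + rho y.
  apply: (@ext_in_inj _ _ _ _ xi); rewrite linearP !rhoP linearP homK_linear.
  by rewrite opprD addrACA -scalerBr.
have rho_in t : rho (ext_in xi t) = t.
  by apply: (@ext_in_inj _ _ _ _ xi); rewrite rhoP ext_in0 homK0 subr0.
(* After subtraction of an inner derivation, d vanishes on T and descends to S. The map h from xi to
   the twisted extension then makes its pullback to xi inner. *)
pose d1 := der_sub d (homK_comp psi (HomK rho_l)).
have d1_in a t : d1 a (ext_in xi t) = 0.
  by rewrite /= -linearZ_LR !rho_in -psiP subrr.
have d1_out a x y : ext_out xi x = ext_out xi y -> d1 a x = d1 a y.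
  move=> xy; have /ext_exact [t tE] : ext_out xi (x - y) = 0 by rewrite linearB xy subrr.
  by rewrite -[x](subrK y) derDr -tE d1_in add0r.
have [d2 d2E] : {d2 : derivation S T | forall a x, d2 a x = d1 a (s x)}.
  have Dl a c x : d1 (a + c) (s x) = d1 a (s x) + d1 c (s x) by rewrite derDl.
  have Dr a x y : d1 a (s (x + y)) = d1 a (s x) + d1 a (s y) by rewrite homKD derDr.
  have Dm a c x : d1 (a * c) (s x) = a *: d1 c (s x) + d1 a (s (c *: x)).
    by rewrite derM; congr (_ + _); apply: d1_out; rewrite linearZ_LR !sP.
  have Da (k : K) x : d1 k%:A (s x) = 0 by rewrite der_alg.
  by exists (Derivation Dl Dr Dm Da).
have [phi [h [_ h_out]]] := xi_gen (twist_extension d2).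
have h2 x : (h x : twist d2).2 = ext_out xi x by apply: h_out.
have h1 a x y : (h (a *: x + y) : twist d2).1 =
    a *: (h x : twist d2).1 + d1 a x + (h y : twist d2).1.
  rewrite linearP /= h2 d2E; congr (_ + _ + _).
  by apply: d1_out; rewrite sP.
have tl (k : K) x y : - (h (k%:A *: x + y) : twist d2).1 =
    k%:A *: - (h x : twist d2).1 - (h y : twist d2).1.
  by rewrite h1 der_alg addr0 opprD scalerN.
apply: (@der_sub_inner _ _ d _ (HomK tl)) => a x.
rewrite -/d1 /= -[a *: x in RHS]addr0 h1 linear0 addr0 opprK scalerN.
by rewrite addrA addNr add0r.
Qed.

(** Exactness of Hom(S, S) -> Ext^1(S, T) -> Ext^1(S, xi) -> Ext^1(S, S) = 0: the hypothesis makes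
    the connecting map psi |-> xi psi surjective. *)
Lemma ext0_middle_right :
  (forall eta : extension S T, exists psi : {linear S -> S}, ext_ract xi psi eta) ->
  ext0 S S -> ext0 S xi.
Proof.
move=> xi_gen SS d.
have [psi psiP] := SS (der_post (ext_out xi) d).
have [s sP] := ext_section.
pose d1 := der_sub d (homK_comp s psi).
have d1_out a x : ext_out xi (d1 a x) = 0.
  by rewrite /= 2!(linearB (ext_out xi)) linearZ_LR !sP -psiP subrr.
have /choice [u uP] (p : A * S) : exists t, ext_in xi t = d1 p.1 p.2.
  by apply/ext_exact.
have [d2 d2E] : {d2 : derivation S T | forall a x, ext_in xi (d2 a x) = d1 a x}.
  have in_inj := @ext_in_inj _ _ _ _ xi.
  have Dl a c x : u (a + c, x) = u (a, x) + u (c, x).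
    by apply: in_inj; rewrite linearD !uP derDl.
  have Dr a x y : u (a, x + y) = u (a, x) + u (a, y).
    by apply: in_inj; rewrite linearD !uP derDr.
  have Dm a c x : u (a * c, x) = a *: u (c, x) + u (a, c *: x).
    by apply: in_inj; rewrite linearP !uP derM.
  have Da (k : K) x : u (k%:A, x) = 0.
    by apply: in_inj; rewrite linear0 uP der_alg.
  by exists (Derivation Dl Dr Dm Da) => a x; rewrite /= uP.
have [psi' [h [h_in _]]] := xi_gen (twist_extension d2).
pose E : lmodType A := twist d2.
have hZ a x : h ((0, a *: x) : E) = a *: h ((0, x) : E) - d1 a x.
  have -> : ((0, a *: x) : E) = a *: ((0, x) : E) - twist_in d2 (d2 a x).
    by congr pair; rewrite /= ?scaler0 ?add0r ?subrr ?subr0.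
  by rewrite linearB linearZ_LR h_in d2E.
have tl (k : K) x y : h ((0, k%:A *: x + y) : E) = k%:A *: h ((0, x) : E) + h ((0, y) : E).
  have -> : ((0, k%:A *: x + y) : E) = k%:A *: ((0, x) : E) + ((0, y) : E).
    by congr pair; rewrite /= der_alg scaler0 !addr0.
  by rewrite linearP.
apply: (@der_sub_inner _ _ d _ (HomK tl)) => a x.
by rewrite -/d1 /= hZ subKr.
Qed.

End Extension.
End Ext.

(** * Intersections of annihilators and the two braid inclusions *)

Section Main.
Variables (K : fieldType) (A : algType K).
Implicit Types (S T X Y : lmodType A).

Lemma calabi_yau_ext0 X Y : calabi_yau A 2 -> fin_dim X -> fin_dim Y ->
  ext0 X Y -> ext0 Y X.
Proof.
move=> /calabi_yau2_data [D] /fin_dim_basis [n [e]] /fin_dim_basis [m [e']].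
exact: (cy2_ext0 D e e').
Qed.

Lemma Ann_capI S T : fin_dim S -> simple_module S -> fin_dim T -> simple_module T ->
  ext0 T S -> forall x, Ann S x -> Ann T x -> ideal_mul (Ann S) (Ann T) x.
Proof.
move=> S_fin S_simple T_fin T_simple TS x Sx Tx; apply: contrapT => nx.
have [r [e [w ewP]]] := simple_frame S_fin S_simple.
have [r' [e' [w' ewP']]] := simple_frame T_fin T_simple.
have [n [b]] := fin_dim_basis T_fin.
have [||||g [gP _ gx]] := isotypic_separation S_simple ewP (M := A^o) (L := Ann T)
  (C0 := ideal_mul (Ann S) (Ann T)) _ _ _ _ Tx nx.
- exact: submod_Ann.
- by apply: submod_ideal_mul => c d; apply: AnnMl.
- by move=> y; apply: ideal_mul_Ann_subr.
- by move=> a y; apply: ideal_mul_mem.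
have TA : filt T (Ann T : set A^o) setT.
  apply: (filt_isotypic T_simple ewP') => //; first exact: submod_Ann.
    by move=> a y Ta _; apply: AnnMr.
  exact: fin_gen_setT.
have [G [GP GE]] := filt_extend b TS TA gP.
(* g(x) = G(x) = x G(1) vanishes because x kills S, against the choice of g. *)
have := Sx (G (1 : A)); rewrite -(linear_onZ _ GP) //.
have -> : (x : A) *: (1 : A^o) = x by apply: mulr1.
by rewrite (GE x Tx).2.
Qed.

Section Braid.
Variables (S T : lmodType A).
Hypotheses (A_cy : calabi_yau A 2).
Hypotheses (S_fin : fin_dim S) (S_simple : simple_module S) (SS : ext0 S S).
Hypotheses (T_fin : fin_dim T) (T_simple : simple_module T) (TT : ext0 T T).
Variable xi : extension S T.
Hypothesis S_xi : ext0 S xi.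
Hypothesis xi_T : ext0 xi T.

Lemma xi_fin : fin_dim xi.
Proof. by have [n [b]] := fin_dim_basis S_fin; apply: ext_fin_dim b _ T_fin. Qed.

Lemma mul_Ann_ext a (x : xi) : ideal_mul (Ann T) (Ann S) a -> a *: x = 0.
Proof.
apply: (ideal_mul_min (C := fun a => a *: x = 0)); first by rewrite scale0r.
  by move=> c d c0 d0; rewrite scalerDl c0 d0 addr0.
move=> c d Tc Sd; have /ext_exact [t tE] : ext_out xi (d *: x) = 0.
  by rewrite linearZ_LR Sd.
by rewrite -scalerA -tE -linearZ_LR Tc linear0.
Qed.

(* A homomorphism I_S I_T -> T -> xi extends to A because xi is injective     *)
(* relative to S and T.                                                       *)
Lemma braid_subset_injective x :
  ideal_mul (ideal_mul (Ann S) (Ann T)) (Ann S) x ->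
  ideal_mul (ideal_mul (Ann T) (Ann S)) (Ann T) x.
Proof.
have T_xi : ext0 T xi := calabi_yau_ext0 A_cy xi_fin T_fin xi_T.
have [D] := calabi_yau2_data A_cy.
have [r [e [w ewP]]] := simple_frame S_fin S_simple.
have [r' [e' [w' ewP']]] := simple_frame T_fin T_simple.
have [n [b]] := fin_dim_basis S_fin; have [m [b']] := fin_dim_basis T_fin.
move=> xSTS; apply: contrapT => /ideal_mulA nx.
pose L : set A^o := ideal_mul (Ann S) (Ann T).
have LP : submod L by apply: submod_ideal_mul => c d; apply: AnnMl.
have Lx : L x.
  move: x xSTS {nx}; apply: ideal_mul_min; [exact: ideal_mul0 | exact: ideal_mulD|].
  by move=> y z Ly _; apply: ideal_mul_rmul => // c d; apply: AnnMr.
have [||||g [gP _ gx]] := isotypic_separation T_simple ewP' (M := A^o) (L := L)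
  (C0 := ideal_mul (Ann T) (ideal_mul (Ann S) (Ann T))) LP _ _ _ Lx.
- by apply: submod_ideal_mul => c d; apply: AnnMl.
- apply: ideal_mul_min; [exact: ideal_mul0 | exact: ideal_mulD|].
  by move=> y z _; apply: ideal_mul_lmul => c d; apply: AnnMl.
- by move=> a y; apply: ideal_mul_mem.
- exact: nx.
have LT : filt S L (Ann T : set A^o).
  apply: (filt_isotypic S_simple ewP) => //; first exact: submod_Ann.
  - by move=> y; apply: ideal_mul_Ann_subr.
  - by move=> a y; apply: ideal_mul_mem.
  - exact: fin_gen_Ann D _ T_fin T_simple.
have TA : filt T (Ann T : set A^o) setT.
  apply: (filt_isotypic T_simple ewP') => //; first exact: submod_Ann.
    by move=> a y Ta _; apply: AnnMr.
  exact: fin_gen_setT.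
have [|G1 [G1P G1E]] := filt_extend (g := fun y => ext_in xi (g y)) b S_xi LT.
  by move=> a y z Ly Lz; rewrite gP // linearP.
have [G [GP GE]] := filt_extend b' T_xi TA G1P.
have [Tx G1x] := G1E x Lx; have [_ Gx] := GE x Tx.
(* The image of g x in xi is G x = x G(1), and x lies in I_S (I_T I_S), whose second factor already
   kills xi. *)
apply: gx; apply: (@ext_in_inj _ _ _ _ xi); rewrite linear0 -G1x -Gx.
have -> : x = (x : A) *: (1 : A^o) by rewrite [RHS]mulr1.
rewrite (linear_onZ _ GP) //; move: (G (1 : A)) => y.
have /ideal_mulA := xSTS; move: (x); apply: ideal_mul_min.
- by rewrite scale0r.
- by move=> c d c0 d0; rewrite scalerDl c0 d0 addr0.
- by move=> c d _ TSd; rewrite -scalerA (mul_Ann_ext _ TSd) scaler0.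
Qed.

(* The relative projectivity of xi lets each w_i be corrected modulo I_S to   *)
(* an element annihilated by Ann(eps) modulo the kernel of I_T I_S -> S.      *)
Lemma braid_subset_projective x :
  (forall eps : xi, ext_out xi eps <> 0 -> forall y, exists a : A, a *: eps = y) ->
  ideal_mul (ideal_mul (Ann T) (Ann S)) (Ann T) x ->
  ideal_mul (ideal_mul (Ann S) (Ann T)) (Ann S) x.
Proof.
move=> xi_gen xTST.
have xi_S : ext0 xi S := calabi_yau_ext0 A_cy S_fin xi_fin S_xi.
have [D] := calabi_yau2_data A_cy.
have [r [e [w ewP]]] := simple_frame S_fin S_simple.
have [r' [e' [w' ewP']]] := simple_frame T_fin T_simple.
have [m [b]] := fin_dim_basis xi_fin.
apply: contrapT => /ideal_mulA nx.
pose L : set A^o := ideal_mul (Ann T) (Ann S).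
have LP : submod L by apply: submod_ideal_mul => c d; apply: AnnMl.
have Lx : L x.
  move: x xTST {nx}; apply: ideal_mul_min; [exact: ideal_mul0 | exact: ideal_mulD|].
  by move=> y z Ly _; apply: ideal_mul_rmul => // c d; apply: AnnMr.
have [||||g [gP g0 gx]] := isotypic_separation S_simple ewP (M := A^o) (L := L)
  (C0 := ideal_mul (Ann S) (ideal_mul (Ann T) (Ann S))) LP _ _ _ Lx.
- by apply: submod_ideal_mul => c d; apply: AnnMl.
- apply: ideal_mul_min; [exact: ideal_mul0 | exact: ideal_mulD|].
  by move=> y z _; apply: ideal_mul_lmul => c d; apply: AnnMl.
- by move=> a y; apply: ideal_mul_mem.
- exact: nx.
pose C : set A^o := fun y => L y /\ g y = 0.
have CP : submod C := submod_ker LP gP.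
have LS : filt T L (Ann S : set A^o).
  apply: (filt_isotypic T_simple ewP') => //; first exact: submod_Ann.
  - by move=> y; apply: ideal_mul_Ann_subr.
  - by move=> a y; apply: ideal_mul_mem.
  - exact: fin_gen_Ann D _ S_fin S_simple.
have CL : filt S C L.
  apply: (filt_step (filt_refl S C) LP gP) => // s.
  have [a <-] := simple_gen s S_simple gx.
  by exists (a *: (x : A^o)); [apply: submodZ | rewrite (linear_onZ LP gP)].
(* I_T I_S I_T I_S lies in I_S (I_T I_S), because I_T I_S lies in I_S; and g kills the latter. *)
have xC z : Ann S z -> C (x * z).
  move=> Sz; suff C0xz : ideal_mul (Ann S) L (x * z).
    split; last exact: g0.
    move: C0xz; apply: ideal_mul_min; [exact: ideal_mul0 | exact: ideal_mulD|].
    by move=> u v _; apply: ideal_mul_lmul => c d; apply: AnnMl.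
  move: (x) xTST; apply: ideal_mul_min.
  - by rewrite mul0r; apply: ideal_mul0.
  - by move=> u v; rewrite mulrDl; apply: ideal_mulD.
  - move=> u v /ideal_mul_Ann_subr Su Tv; rewrite -mulrA.
    by apply: ideal_mul_mem => //; apply: ideal_mul_mem.
(* For a lift eps of e_i, two liftings turn w_i into t2 with Ann(eps) t2 inside C and w_i - t2 in
   I_S. As x kills eps, x t2 lies in C, and x (w_i - t2) does by the previous step. *)
have xw i : C (x * w i).
  have [eps epsE] := ext_out_surj xi (e i).
  have eps_gen : forall y, exists a : A, a *: eps = y.
    by apply: xi_gen; rewrite epsE; apply: (frame_neq0 ewP).
  have [|t1 [St1 t1P]] := filt_lift (t := (w i : A^o)) b xi_T eps_gen LS.
    by move=> a a0; apply: (frame_ann ewP); rewrite -epsE -linearZ_LR a0 linear0.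
  have [t2 [Lt2 t2P]] := filt_lift b xi_S eps_gen CL t1P.
  have St2 : Ann S ((w i : A) - t2).
    rewrite -[w i](subrK t1) -addrA; apply: AnnD => //.
    exact: ideal_mul_Ann_subr Lt2.
  have -> : x * w i = x * (w i - t2) + (x : A) *: t2 by rewrite mulrBr subrK.
  apply: (submodD CP); first exact: xC.
  by apply: (t2P x); apply: mul_Ann_ext.
apply: gx; have : C x; last by case.
have -> : x = \sum_i x * w i + x * (1 - \sum_i w i).
  by rewrite -mulr_sumr mulrBr mulr1 addrC subrK.
apply: (submodD CP); first by apply: (submod_sum CP).
exact/xC/(frame_sum ewP).
Qed.

End Braid.
End Main.

(** * Nonsplit extensions of simple modules and the theorem *)

Section Nonsplit.
Variables (K : fieldType) (A : algType K).
Implicit Types (S T X Y : lmodType A).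

Lemma linear_exists X Y (f : X -> Y) : linear f -> exists g : {linear X -> Y}, g =1 f.
Proof.
move=> fP; pose m := GRing.isLinear.Build A X Y *:%R f fP.
pose g : {linear X -> Y} := HB.pack f m.
by exists g.
Qed.

(* An endomorphism of xi that kills T and lifts the identity of S amounts to  *)
(* a splitting of xi.                                                         *)
Definition ext_nonsplit S T (xi : extension S T) : Prop :=
  forall h : {linear xi -> xi}, (forall t, h (ext_in xi t) = 0) ->
    (forall x, ext_out xi (h x) = ext_out xi x) -> False.

(** Such an endomorphism exhibits xi as its own pushout along 0; it is also its pushout along the
    identity, so uniqueness of the scalar would force T = 0. *)
Lemma universal_nonsplit S T (xi : extension S T) : (exists t : T, t != 0) ->
  (forall eta : extension S T, exists phi : {linear T -> T}, ext_lact phi xi eta /\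
     forall phi' : {linear T -> T}, ext_lact phi' xi eta -> phi' =1 phi) ->
  ext_nonsplit xi.
Proof.
move=> [t /eqP t0] xi_univ h h_in h_out; have [phi [_ phi_uniq]] := xi_univ xi.
apply: t0; rewrite -[t]/(idfun t) (phi_uniq idfun); last by exists idfun.
rewrite -(phi_uniq \0) //; exists h; split=> // u.
by rewrite h_in linear0.
Qed.

(** A eps maps onto S and meets T in 0 or T. In the first case A eps is a complement of T, and
    projection onto it contradicts nonsplitness; in the second A eps contains T and is
    everything. *)
Lemma nonsplit_generated S T (xi : extension S T) : simple_module S -> simple_module T ->
  ext_nonsplit xi ->
  forall eps : xi, ext_out xi eps <> 0 -> forall y, exists a : A, a *: eps = y.
Proof.
move=> S_simple T_simple nsplit eps eps0 y.
have S_gen s : exists a : A, a *: ext_out xi eps = s by apply: simple_gen.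
have ker_eps (a : A) : a *: ext_out xi eps = 0 -> exists t, ext_in xi t = a *: eps.
  by move=> a0; apply/ext_exact; rewrite linearZ_LR.
have [|V0|VT] := @simple_submod K A T (fun t => exists a : A, a *: eps = ext_in xi t) T_simple.
- split=> [|a t u [c cE] [d dE]]; first by exists 0; rewrite scale0r linear0.
  by exists (a * c + d); rewrite linearP scalerDl -cE -dE scalerA.
- have /choice [a aP] x := S_gen (ext_out xi x).
  have ann (c : A) : c *: ext_out xi eps = 0 -> c *: eps = 0.
    move=> c0; have [t tE] := ker_eps c c0.
    by rewrite -tE (V0 t) ?linear0 //; exists c.
  have hl : linear (fun x => a x *: eps).
    move=> c x z; apply/eqP; rewrite scalerA -scalerDl -subr_eq0 -scalerBl; apply/eqP/ann.
    by rewrite scalerBl scalerDl -scalerA !aP linearP subrr.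
  have [h hE] := linear_exists hl; case: (nsplit h) => [t|x]; rewrite hE.
    by apply: ann; rewrite aP ext_in0.
  by rewrite linearZ_LR aP.
have [a aE] := S_gen (ext_out xi y).
have /ext_exact [t tE] : ext_out xi (y - a *: eps) = 0.
  by rewrite linearB linearZ_LR aE subrr.
have [c cE] := VT t; exists (c + a).
by rewrite scalerDl cE tE subrK.
Qed.

(* psi is nonzero because xi does not split, hence invertible by Schur.       *)
Lemma nonsplit_iso S T (xi xi' : extension S T) (psi : {linear S -> S}) :
  simple_module S -> ext_nonsplit xi -> ext_ract xi' psi xi ->
  exists h : {linear xi -> xi'}, injective h /\ forall y, exists x, h x = y.
Proof.
move=> S_simple nsplit [h [h_in h_out]]; exists h.
have in'_inj := @ext_in_inj _ _ _ _ xi'.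
have psi_neq0 : ~ (forall s, psi s = 0).
  move=> psi0; have /choice [rho rhoP] x : exists t, ext_in xi' t = h x.
    by apply/ext_exact; rewrite h_out psi0.
  have rho_in t : rho (ext_in xi t) = t by apply: in'_inj; rewrite rhoP h_in.
  have kl : linear (fun x => x - ext_in xi (rho x)).
    move=> a x y; have -> : rho (a *: x + y) = a *: rho x + rho y.
      by apply: in'_inj; rewrite linearP !rhoP linearP.
    by rewrite linearP opprD addrACA -scalerBr.
  have [k kE] := linear_exists kl; case: (nsplit k) => [t|x]; rewrite kE.
    by rewrite rho_in subrr.
  by rewrite linearB ext_in0 subr0.
have psi_ker s : psi s = 0 -> s = 0.
  have [|V0|//] := @simple_submod K A S (fun s => psi s = 0) S_simple.
    split=> [|a x y x0 y0]; first exact: linear0.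
    by rewrite linearP x0 y0 scaler0 addr0.
  exact: V0.
have psi_surj s : exists s', psi s' = s.
  have [|V0|//] := @simple_submod K A S (fun s => exists s', psi s' = s) S_simple.
    split=> [|a _ _ [x <-] [y <-]]; first by exists 0; apply: linear0.
    by exists (a *: x + y); rewrite linearP.
  by case: psi_neq0 => s'; apply: V0; exists s'.
split=> [x y xy|y].
  apply/eqP; rewrite -subr_eq0; apply/eqP.
  have hxy : h (x - y) = 0 by rewrite linearB xy subrr.
  have /ext_exact [t tE] : ext_out xi (x - y) = 0.
    by apply: psi_ker; rewrite -h_out hxy linear0.
  have t0 : t = 0 by apply: in'_inj; rewrite -[LHS]h_in tE hxy linear0.
  by rewrite -tE t0 linear0.
have [s sE] := psi_surj (ext_out xi' y); have [x xE] := ext_out_surj xi s.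
have /ext_exact [t tE] : ext_out xi' (y - h x) = 0.
  by rewrite linearB h_out xE sE subrr.
by exists (ext_in xi t + x); rewrite linearD h_in tE subrK.
Qed.

End Nonsplit.

Theorem proposition1p6 (K : fieldType) (A : algType K) (S T : lmodType A)
  (hA : calabi_yau A 2)
  (S_fin : fin_dim S) (S_simple : simple_module S) (S_rigid : rigid S)
  (T_fin : fin_dim T) (T_simple : simple_module T) (T_rigid : rigid T) :
  let I_S := Ann S in
  let I_T := Ann T in
  [/\ ideal_mul I_S I_S = I_S,
      Ext1_zero S T -> ideal_mul I_S I_T = ideal_mul I_T I_S
    & Ext1_dim1_right S T -> Ext1_dim1_left S T ->
      ideal_mul (ideal_mul I_S I_T) I_S = ideal_mul (ideal_mul I_T I_S) I_T].
Proof.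
move=> I_S I_T.
have SS := Ext1_zero_ext0 S_rigid; have TT := Ext1_zero_ext0 T_rigid.
split.
- apply/seteqP; split=> x; first exact: ideal_mul_Ann_subl.
  by move=> Sx; apply: Ann_capI.
- move=> /Ext1_zero_ext0 ST; have TS := calabi_yau_ext0 hA S_fin T_fin ST.
  (* Both products equal the intersection of I_S and I_T, since Ext^1 vanishes in both
     directions. *)
  apply/seteqP; split=> x Ix; apply: Ann_capI => //;
    by [exact: ideal_mul_Ann_subl Ix | exact: ideal_mul_Ann_subr Ix].
- move=> [xi_r xi_rP] [xi xiP].
  have [n [b]] := fin_dim_basis S_fin.
  have nsplit : ext_nonsplit xi by apply: universal_nonsplit xiP; case: T_simple.
  have xi_T : ext0 xi T.
    by apply: (ext0_middle_left b) TT => eta; have [phi []] := xiP eta; exists phi.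
  have S_xir : ext0 S xi_r.
    by apply: (ext0_middle_right b) SS => eta; have [psi []] := xi_rP eta; exists psi.
  (* The generators for the two module structures may differ. But xi is a multiple of [xi_r], and
     nonsplitness makes the middle terms isomorphic, so the vanishing for [xi_r] passes to xi. *)
  have [psi [xi_psi _]] := xi_rP xi.
  have [h [h_inj h_surj]] := nonsplit_iso S_simple nsplit xi_psi.
  have S_xi := ext0_iso h_inj h_surj S_xir.
  apply/seteqP; split=> x Ix.
    exact: (braid_subset_injective hA S_fin S_simple T_fin T_simple S_xi xi_T).
  apply: (braid_subset_projective hA S_fin S_simple T_fin T_simple S_xi xi_T) Ix.
  exact: nonsplit_generated.
Qed.
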